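(* Let $\Omega=(0,1)\times(0,1)$, let $h:[0,1]\to\mathbb{R}$ be a bounded function with $h(0)=0$, $h(x_1)>0$ for $x_1\in(0,1]$, $h\in C^1(0,1]$, satisfying, for some constants $C>0$ and $\theta\in(0,1)$, $$\sup_{x\in\Omega,\ 0<r\le d}\frac{\int_{B(x,r)\cap\Omega}h(x_1)^{-1}\,dx}{|B(x,r)\cap\Omega|^{\theta}}\le C$$ ($d$ the diameter of $\Omega$). Let $S=\{V\in L^\infty(\Omega)\mid m\le V(x)\le M \text{ a.e.}\}$ with $m,M$ given nonnegative constants, and for $V\in S$ let $\Gamma(V)=\lambda_2(V)-\lambda_1(V)$. Then there exists $V^*\in S$ with $\Gamma(V^* )=\inf_{V\in S}\Gamma(V)$.
   Context: $\mathcal{H}_h^1(\Omega)=\{u\in L^2(\Omega)\mid \partial_{x_1}u\in L^2(\Omega),\ \sqrt{h(x_1)}\,\partial_{x_2}u\in L^2(\Omega)\}$; $\mathcal{H}_{h,0}^1(\Omega)$ is the closure of $C_0^\infty(\Omega)$ in $\mathcal{H}_h^1(\Omega)$. For $V\in S$, $\lambda_1(V)\le\lambda_2(V)\le\cdots$ are the eigenvalues (counted with multiplicity) of the Dirichlet problem $-(\partial_{x_1x_1}u+h(x_1)\partial_{x_2x_2}u)+Vu=\lambda u$ in $\Omega$, $u=0$ on $\partial\Omega$, understood weakly: $u\in\mathcal{H}_{h,0}^1(\Omega)\setminus\{0\}$ and $\int_\Omega \partial_{x_1}u\,\partial_{x_1}v+h(x_1)\partial_{x_2}u\,\partial_{x_2}v+Vuv\,dx=\lambda\int_\Omega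 uv\,dx$ for all $v\in\mathcal{H}_{h,0}^1(\Omega)$. *)

(* Defs.v *)
From HB Require Import structures.
From mathcomp Require Import all_boot all_order all_algebra.
From mathcomp Require Import all_classical all_reals all_analysis.
Import Order.TTheory GRing.Theory Num.Theory numFieldNormedType.Exports.
Set Implicit Arguments. Unset Strict Implicit. Unset Printing Implicit Defensive.
Local Open Scope classical_set_scope.
Local Open Scope ring_scope.

Section Defs.
Variable R : realType.

Definition mu2 := ((@lebesgue_measure R) \x (@lebesgue_measure R))%E.

Definition Om : set (R * R) := [set x | (0 < x.1 < 1) /\ (0 < x.2 < 1)].

Definition ball2 (x : R * R) (r : R) : set (R * R) :=
  [set y | (y.1 - x.1) ^+ 2 + (y.2 - x.2) ^+ 2 < r ^+ 2].

Definition e1 : R * R := (1, 0).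
Definition e2 : R * R := (0, 1).

Fixpoint iterD (l : seq (R * R)) (f : R * R -> R) : R * R -> R :=
  match l with
  | [::] => f
  | v :: l' => 'D_v (iterD l' f)
  end.

Definition smooth (f : R * R -> R) : Prop :=
  forall l : seq (R * R),
    continuous (iterD l f) /\ (forall v x, derivable (iterD l f) x v).

Definition test_fun (phi : R * R -> R) : Prop :=
  smooth phi /\
  exists K : set (R * R), [/\ compact K, K `<=` Om & forall x, ~ K x -> phi x = 0].

Definition L2 (u : R * R -> R) : Prop :=
  measurable_fun Om u /\ (\int[mu2]_(x in Om) ((u x) ^+ 2)%:E < +oo)%E.

Definition weak_deriv (v : R * R) (u g : R * R -> R) : Prop :=
  forall phi, test_fun phi ->
    mu2.-integrable Om (fun x => (g x * phi x)%:E) /\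
    Rintegral mu2 Om (fun x => u x * 'D_v phi x)
    = - Rintegral mu2 Om (fun x => g x * phi x).

Definition Hh1 (h : R -> R) (u g1 g2 : R * R -> R) : Prop :=
  [/\ L2 u, L2 g1 & weak_deriv e1 u g1] /\
  [/\ measurable_fun Om g2, weak_deriv e2 u g2
     & L2 (fun x => Num.sqrt (h x.1) * g2 x)].

Definition Hh10 (h : R -> R) (u g1 g2 : R * R -> R) : Prop :=
  Hh1 h u g1 g2 /\
  exists phi : nat -> (R * R -> R),
    (forall n, test_fun (phi n)) /\
    ((fun n => \int[mu2]_(x in Om)
        (((phi n x - u x) ^+ 2 + ('D_e1 (phi n) x - g1 x) ^+ 2
          + h x.1 * ('D_e2 (phi n) x - g2 x) ^+ 2)%:E)) @ \oo --> 0%E)%E.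

Definition eigenfun (h : R -> R) (V : R * R -> R) (lam : R) (u : R * R -> R) : Prop :=
  exists g1 g2, [/\ Hh10 h u g1 g2,
    ~ {ae mu2, forall x, Om x -> u x = 0} &
    forall v w1 w2, Hh10 h v w1 w2 ->
      Rintegral mu2 Om (fun x => g1 x * w1 x + h x.1 * g2 x * w2 x + V x * u x * v x)
      = lam * Rintegral mu2 Om (fun x => u x * v x)].

Definition eigenvalue (h : R -> R) (V : R * R -> R) (lam : R) : Prop :=
  exists u, eigenfun h V lam u.

Definition mult_ge2 (h : R -> R) (V : R * R -> R) (lam : R) : Prop :=
  exists u1 u2, [/\ eigenfun h V lam u1, eigenfun h V lam u2 &
    forall a b : R, {ae mu2, forall x, Om x -> a * u1 x + b * u2 x = 0} ->
      a = 0 /\ b = 0].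

(* lambda_1 <= lambda_2, counted with multiplicity *)
Definition lambda1 (h : R -> R) (V : R * R -> R) : R :=
  inf [set l | eigenvalue h V l].

Definition lambda2 (h : R -> R) (V : R * R -> R) : R :=
  if `[< mult_ge2 h V (lambda1 h V) >] then lambda1 h V
  else inf [set l | eigenvalue h V l /\ lambda1 h V < l].

Definition Gamma (h : R -> R) (V : R * R -> R) : R := lambda2 h V - lambda1 h V.

Definition inS (m M : R) (V : R * R -> R) : Prop :=
  measurable_fun Om V /\ {ae mu2, forall x, Om x -> m <= V x <= M}.

End Defs.

Arguments mu2 {R}.
Arguments Om {R}.
Arguments e1 {R}.
Arguments e2 {R}.

(* Main.v *)
Require Import Defs.
From HB Require Import structures.
From mathcomp Require Import all_boot all_order all_algebra.
From mathcomp Require Import all_classical all_reals all_analysis.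
From mathcomp Require Import measurable_realfun ring lra.
Import Order.TTheory GRing.Theory Num.Theory numFieldNormedType.Exports.
Local Open Scope classical_set_scope.
Local Open Scope ring_scope.

(** Form sums over the square are compact perturbations: on the Hilbert space X of
    triples (u, g1, g2) the L^2 mass b of u is compact relative to the energy a0
    (a cell-by-cell Poincare inequality; in the first column of cells one uses
    u = 0 on x.1 = 0 instead of a lower bound for h). Hence Rayleigh quotients of
    a0 + p_V, p_V(x, x) = int V u^2, attain their minima, by the parallelogram
    identity along minimising sequences, and lambda_1 and lambda_1 + lambda_2 are
    the minima of a(x, x) over unit vectors and of a(x, x) + a(y, y) over
    orthonormal pairs. Along a minimising sequence V_n of the gap take the weak
    limit W of V_n along an ultrafilter. Compactness makes the convergence of
    p_{V_n} to p_W uniform on energy-bounded sets, so lambda_1 is upper and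
    lambda_1 + lambda_2 lower semicontinuous, and the gap
    (lambda_1 + lambda_2) - 2 lambda_1 of W does not exceed the infimum. If X has
    dimension at most one modulo the kernel of b the same argument applies to
    - lambda_1, so no nonzero test function has to be exhibited. *)

(** * Positive semidefinite forms *)

(** The trace characterisation by orthonormal pairs makes no reference to a first eigenvector; this
    is why lambda_1 + lambda_2 passes to the limit although the eigenvectors of V_n vary with n.
    Each half of the gap needs only a one-sided estimate: a trial vector of W bounds lambda_1 of V_n
    from above, and the minimising pairs of V_n serve as trial pairs for W. The degeneracy of h is
    felt twice. The derivative g2 is square integrable only after multiplication by sqrt h, so its
    defining identity survives limits by pairing sqrt h g2 with phi / sqrt h; the latter lies in L^2
    because 1/h is integrable, which is the ball condition at radius sqrt 2. And h need not have a
    positive lower bound, so the cells are anisotropic: their width is fixed first, then h is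
    bounded below off the first column, and the height is chosen according to that bound. Weak L^2
    limits of potentials cannot be tested against u^2, which is only integrable; u is first replaced
    by a continuous function. *)

Section Forms.
Context {R : realType} {E : lmodType R}.
Implicit Types (X : E -> Prop) (f g : E -> E -> R) (x y z : E).

Definition linsub X := X 0 /\ forall k x y, X x -> X y -> X (k *: x + y).

(** The axioms are relative to X because an integral form is a total function that is bilinear only
    where its integrals converge. Null vectors are allowed: functions equal almost everywhere are
    not identified. *)
Definition psd X f :=
  [/\ forall x y, X x -> X y -> f x y = f y x,
      forall k x y z, X x -> X y -> X z -> f (k *: x + y) z = k * f x z + f y z
    & forall x, X x -> 0 <= f x x].

Definition form_add f g x y := f x y + g x y.

Definition seq_complete X f := forall s : nat -> E, (forall n, X (s n)) ->
  (forall e, 0 < e -> exists n0, forall i j, (n0 <= i)%N -> (n0 <= j)%N ->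
     f (s i - s j) (s i - s j) <= e) ->
  exists2 x, X x & (fun n => f (s n - x) (s n - x)) @ \oo --> 0.

Lemma linsubZ X k x : linsub X -> X x -> X (k *: x).
Proof. by move=> [X0 XD] Xx; rewrite -[k *: x]addr0; exact: XD. Qed.

Lemma linsubD X x y : linsub X -> X x -> X y -> X (x + y).
Proof. by move=> [X0 XD] Xx Xy; rewrite -[x]scale1r; exact: XD. Qed.

Lemma linsubB X x y : linsub X -> X x -> X y -> X (x - y).
Proof.
move=> sX Xx Xy; apply: linsubD => //.
by rewrite -scaleN1r; exact: linsubZ.
Qed.

Lemma psd_add X f g : psd X f -> psd X g -> psd X (form_add f g).
Proof.
move=> [f1 f2 f3] [g1 g2 g3]; split; rewrite /form_add.
- by move=> x y Xx Xy; rewrite f1// g1.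
- by move=> k x y z Xx Xy Xz; rewrite f2// g2//; ring.
- by move=> x Xx; rewrite addr_ge0 ?f3 ?g3.
Qed.

Lemma psd_sub X Y f : (forall x, Y x -> X x) -> psd X f -> psd Y f.
Proof.
move=> YX [f1 f2 f3]; split.
- by move=> x y /YX Xx /YX Xy; exact: f1.
- by move=> k x y z /YX Xx /YX Xy /YX Xz; exact: f2.
- by move=> x /YX; exact: f3.
Qed.

(** First variation at a minimum: t = - c / (d + 1) turns the expression into a negative multiple of
    c^2, the added 1 covering d = 0. *)
Lemma small_quad (c d : R) : (forall t, 0 <= 2 * t * c + t ^+ 2 * d) -> c = 0.
Proof.
move=> H; have d0 : 0 <= d by have := H 1; have := H (-1); rewrite !expr2; lra.
have d1 : 0 < d + 1 by lra.
have := H (- c / (d + 1)).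
have -> : 2 * (- c / (d + 1)) * c + (- c / (d + 1)) ^+ 2 * d
  = - (c ^+ 2 * ((d + 2) / (d + 1) ^+ 2)) by field; lra.
rewrite oppr_ge0 pmulr_lle0; last by rewrite divr_gt0// ?exprn_gt0//; lra.
by move=> c2; apply/eqP; rewrite -sqrf_eq0 eq_le c2 sqr_ge0.
Qed.

Lemma small_invS (e : R) : 0 < e ->
  exists n0, forall n, (n0 <= n)%N -> n.+1%:R^-1 <= e.
Proof.
move=> e0; have [n0 _ Hn0] := near_infty_natSinv_lt (PosNum e0).
by exists n0 => n n0n; have /= /ltW := Hn0 n n0n.
Qed.

(** * Calculus of one semidefinite form *)

Section OneForm.
Context {X : E -> Prop} {f : E -> E -> R}.
Hypotheses (sX : linsub X) (pf : psd X f).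

Lemma psdC x y : X x -> X y -> f x y = f y x.
Proof. by case: pf => + _ _; exact. Qed.
Lemma psdl k x y z : X x -> X y -> X z -> f (k *: x + y) z = k * f x z + f y z.
Proof. by case: pf => _ + _; exact. Qed.
Lemma psd_ge0 x : X x -> 0 <= f x x.
Proof. by case: pf => _ _; exact. Qed.
Lemma psd0l z : X z -> f 0 z = 0.
Proof.
move=> Xz; have X0 := sX.1.
by have := @psdl 1 0 0 z X0 X0 Xz; rewrite scale1r addr0; lra.
Qed.
Lemma psdDl x y z : X x -> X y -> X z -> f (x + y) z = f x z + f y z.
Proof. by move=> *; rewrite -[x in LHS]scale1r psdl// mul1r. Qed.
Lemma psdZl k x z : X x -> X z -> f (k *: x) z = k * f x z.
Proof. by move=> *; rewrite -[k *: x in LHS]addr0 psdl ?psd0l ?addr0//; exact: sX.1. Qed.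
Lemma psdBl x y z : X x -> X y -> X z -> f (x - y) z = f x z - f y z.
Proof. by move=> *; rewrite addrC -scaleN1r psdl//; ring. Qed.
Lemma psdr k x y z : X x -> X y -> X z -> f z (k *: x + y) = k * f z x + f z y.
Proof.
by move=> *; rewrite psdC ?psdl// ?(psdC _ z)//; case: sX => _; exact.
Qed.
Lemma psd_quad k x y : X x -> X y ->
  f (k *: x + y) (k *: x + y) = k ^+ 2 * f x x + 2 * k * f x y + f y y.
Proof.
move=> Xx Xy; have Xk : X (k *: x + y) by case: sX => _; exact.
by rewrite psdl// !psdr// (psdC y x)//; ring.
Qed.
Lemma psd_quadD x y : X x -> X y -> f (x + y) (x + y) = f x x + 2 * f x y + f y y.
Proof. by move=> *; rewrite -{1 2}[x]scale1r psd_quad//; ring. Qed.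
Lemma psd_quadB x y : X x -> X y -> f (x - y) (x - y) = f x x - 2 * f x y + f y y.
Proof.
move=> *; rewrite addrC -scaleN1r psd_quad// (psdC y x)//; ring.
Qed.
Lemma psd_quadZ k x : X x -> f (k *: x) (k *: x) = k ^+ 2 * f x x.
Proof. by move=> Xx; rewrite psdZl ?(psdC x) ?psdZl//; [ring|exact: linsubZ..]. Qed.
Lemma psd_quadN x y : X x -> X y -> f (x - y) (x - y) = f (y - x) (y - x).
Proof. by move=> *; rewrite !psd_quadB// (psdC y x)//; ring. Qed.

Lemma psd_quad_le2 x y : X x -> X y -> f (x + y) (x + y) <= 2 * f x x + 2 * f y y.
Proof.
move=> Xx Xy; have := psd_ge0 _ (linsubB _ _ _ sX Xx Xy).
by rewrite psd_quadB// psd_quadD//; lra.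
Qed.

Lemma psd_quadB_le2 x y z : X x -> X y -> X z ->
  f (x - y) (x - y) <= 2 * f (x - z) (x - z) + 2 * f (z - y) (z - y).
Proof.
move=> Xx Xy Xz; rewrite -[x - y](_ : (x - z) + (z - y) = _); last by rewrite addrA subrK.
by apply: psd_quad_le2; exact: linsubB.
Qed.

(** The discriminant argument needs f x x > 0; for a null vector x the quadratic is affine in t and
    stays nonnegative only if f x y = 0. *)
Lemma psd_CS x y : X x -> X y -> f x y ^+ 2 <= f x x * f y y.
Proof.
move=> Xx Xy; have [Hx Hy] := (psd_ge0 _ Xx, psd_ge0 _ Xy).
have H t : 0 <= t ^+ 2 * f x x + 2 * t * f x y + f y y.
  by rewrite -psd_quad//; apply: psd_ge0; case: sX => _; exact.
have [x0|x0] := eqVneq (f x x) 0.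
  suff -> : f x y = 0 by rewrite expr0n /= mulr_ge0.
  apply/eqP; apply: contraT => n0.
  (* This t brings the affine function to the value -1. *)
  have := H (- (f y y + 1) / (2 * f x y)); rewrite x0 mulr0 add0r.
  have -> : 2 * (- (f y y + 1) / (2 * f x y)) * f x y = - (f y y + 1) by field.
  by lra.
have xp : 0 < f x x by rewrite lt_neqAle eq_sym x0.
have := H (- f x y / f x x).
have -> : (- f x y / f x x) ^+ 2 * f x x + 2 * (- f x y / f x x) * f x y + f y y
   = (f x x * f y y - f x y ^+ 2) / f x x by field.
by rewrite pmulr_lge0 ?invr_gt0// subr_ge0.
Qed.

(** The difference factors as f (x - y) (x + y). For a form dominated by K b it makes the values at
    b-close vectors close, with a constant that depends on K alone and not on the form. *)
Lemma psd_quad_diff x y : X x -> X y ->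
  (f x x - f y y) ^+ 2 <= f (x - y) (x - y) * f (x + y) (x + y).
Proof.
move=> Xx Xy.
have XB := linsubB _ _ _ sX Xx Xy; have XD := linsubD _ _ _ sX Xx Xy.
have -> : f x x - f y y = f (x - y) (x + y).
  by rewrite psdBl// !(psdC _ (x + y))// !psdDl// (psdC y x)//; ring.
exact: psd_CS.
Qed.

Lemma psd_cvg0 (s : nat -> E) x y : (forall n, X (s n)) -> X x -> X y ->
  (fun n => f (s n - x) (s n - x)) @ \oo --> 0 ->
  (fun n => f (s n) y) @ \oo --> f x y.
Proof.
move=> Xs Xx Xy cv.
have H : (fun n => f (s n - x) y) @ \oo --> 0.
  apply/norm_cvg0P.
  have sq : (fun n => Num.sqrt (f (s n - x) (s n - x) * f y y)) @ \oo --> 0.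
    rewrite -[X in _ --> X]sqrtr0.
    apply: (@continuous_cvg _ _ _ _ _ _ Num.sqrt); first exact: sqrt_continuous.
    by rewrite -[X in _ --> X](mul0r (f y y)); apply: cvgM => //; exact: cvg_cst.
  apply: (squeeze_cvgr _ (cvg_cst 0) sq); apply: nearW => n /=.
  rewrite normr_ge0 /= -sqrtr_sqr ler_wsqrtr// psd_CS//; exact: linsubB.
rewrite -[X in _ --> X]add0r.
have -> : (fun n => f (s n) y) = (fun n => f (s n - x) y + f x y).
  by apply/funext => n; rewrite psdBl// subrK.
apply: cvgD => //; exact: cvg_cst.
Qed.

Lemma psd_cvg_quad (s : nat -> E) x : (forall n, X (s n)) -> X x ->
  (fun n => f (s n - x) (s n - x)) @ \oo --> 0 ->
  (fun n => f (s n) (s n)) @ \oo --> f x x.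
Proof.
move=> Xs Xx cv.
have c1 := psd_cvg0 s x x Xs Xx Xx cv.
have -> : (fun n => f (s n) (s n)) =
  (fun n => f (s n - x) (s n - x) + (2 * f (s n) x - f x x)).
  by apply/funext => n; rewrite psd_quadB//; ring.
rewrite -[X in _ --> X](_ : 0 + (2 * f x x - f x x) = _); last by ring.
apply: cvgD => //; apply: cvgB; last exact: cvg_cst.
by apply: cvgM => //; exact: cvg_cst.
Qed.

(* The minimiser of f x x - 2 l x; minimising sequences are Cauchy by the
   parallelogram identity. *)
Lemma riesz (l : E -> R) (C : R) : seq_complete X f -> 0 <= C ->
  (forall k x y, X x -> X y -> l (k *: x + y) = k * l x + l y) ->
  (forall x, X x -> l x ^+ 2 <= C * f x x) ->
  exists2 v, X v & forall x, X x -> f v x = l x.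
Proof.
move=> cX C0 llin lbd; have [X0 XD] := sX.
pose J x := f x x - 2 * l x.
have lD x y : X x -> X y -> l (x + y) = l x + l y.
  by move=> Xx Xy; rewrite -[x in LHS]scale1r llin// mul1r.
have lZ k x : X x -> l (k *: x) = k * l x.
  move=> Xx; rewrite -[k *: x]addr0 llin//.
  by have := llin 1 0 0 X0 X0; rewrite scale1r addr0; lra.
(* From l^2 <= C f and 2 sqrt (C f) <= f + C. *)
have Jlb x : X x -> - C <= J x.
  move=> Xx; have Hl := lbd x Xx; have fx := psd_ge0 _ Xx; rewrite /J.
  suff : 2 * l x <= f x x + C by lra.
  have [l0|l0] := leP (l x) 0; first by lra.
  rewrite -ler_sqr ?nnegrE; [|lra|lra].
  have := sqr_ge0 (f x x - C); move: Hl; rewrite !expr2; nra.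
pose S := [set J x | x in X].
have hS : has_inf S.
  split; first by exists (J 0); exists 0.
  by exists (- C) => _ [x Xx <-]; exact: Jlb.
have Jinf x : X x -> inf S <= J x by move=> Xx; apply: ge_inf; [exact: hS.2|exists x].
have /choice[s Hs] : forall n : nat, exists x, X x /\ J x < inf S + n.+1%:R^-1.
  move=> n; have [|_ [x Xx <-] Hx] := @inf_adherent _ S n.+1%:R^-1 _ hS.
    by rewrite invr_gt0.
  by exists x.
have Xs n : X (s n) by case: (Hs n).
have Js n : J (s n) < inf S + n.+1%:R^-1 by case: (Hs n).
have par x y : X x -> X y ->
    f (x - y) (x - y) = 2 * J x + 2 * J y - 4 * J (2^-1 *: (x + y)).
  move=> Xx Xy; have Xxy := linsubD _ _ _ sX Xx Xy.
  rewrite psd_quadB// /J psd_quadZ// lZ// psd_quadD// lD//.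
  by field.
have [e e0|v Xv cv] := cX s Xs.
  have [|n0 Hn0] := small_invS (e / 4); first by rewrite divr_gt0.
  exists n0 => i j /Hn0 Hi /Hn0 Hj; rewrite par//.
  have := Jinf _ (linsubZ _ 2^-1 _ sX (linsubD _ _ _ sX (Xs i) (Xs j))).
  move: (Js i) (Js j) Hi Hj.
  move: (J (s i)) (J (s j)) (J _) (inf S) (i.+1%:R^-1) (j.+1%:R^-1) => *; lra.
exists v => // y Xy.
(* v is compared with v + z through the sequence: J (s n + z) is at least the infimum, hence above J
   (s n) - 1 / (n + 1). The terms l (s n) cancel, so only f (s n) z has to converge. *)
have key z : X z -> 0 <= 2 * (f v z - l z) + f z z.
  move=> Xz.
  have c1 := psd_cvg0 s v z Xs Xv Xz cv.
  have c2 : (fun n => 2 * (f (s n) z - l z) + f z z + n.+1%:R^-1) @ \oo -->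
      2 * (f v z - l z) + f z z.
    rewrite -[X in _ --> X]addr0; apply: cvgD; last exact: cvg_harmonic.
    apply: cvgD; last exact: cvg_cst.
    apply: cvgM; first exact: cvg_cst.
    by apply: cvgB => //; exact: cvg_cst.
  apply: (cvgr_to_ge c2); apply: nearW => n /=.
  have := Jinf _ (linsubD _ _ _ sX (Xs n) Xz); have := Js n.
  by rewrite /J psd_quadD// lD//; move: (n.+1%:R^-1) => *; lra.
apply/eqP; rewrite -subr_eq0; apply/eqP; apply: (@small_quad _ (f y y)) => t.
have := key (t *: y) (linsubZ _ _ _ sX Xy).
rewrite psd_quadZ// lZ// (psdC _ _ Xv (linsubZ _ _ _ sX Xy)) psdZl// (psdC _ _ Xy Xv).
by lra.
Qed.
End OneForm.

Definition functional X f (C : R) (l : E -> R) :=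
  (forall k x y, X x -> X y -> l (k *: x + y) = k * l x + l y) /\
  (forall x, X x -> l x ^+ 2 <= C * f x x).

(** A Friedrichs inequality, taken as the meaning of compactness of b relative to f: up to e f, b is
    controlled by finitely many bounded functionals. An f-bounded sequence is then nearly b-Cauchy
    as soon as finitely many numbers converge. *)
Definition finite_rank_bound X f b := forall e, 0 < e ->
  exists (J : finType) (l : J -> E -> R) C, [/\ 0 <= C, forall i, functional X f C (l i)
    & forall x, X x -> b x x <= e * f x x + \sum_i l i x ^+ 2].

(** A cluster point of the image filter in the compact segment is a limit, since of a set and its
    complement one belongs to U. *)
Lemma ultra_cvg (U : set_system nat) (s : nat -> R) (C : R) : UltraFilter U ->
  (forall n, `|s n| <= C) -> exists c : R, s n @[n --> U] --> c.
Proof.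
move=> uU sC; have pU := @ultra_proper _ _ uU.
have sF : ProperFilter (s @ U) by exact: fmap_proper_filter.
have UC : U (s @^-1` `[- C, C]).
  by apply: (@filterE _ U) => n /=; rewrite in_itv /= -ler_norml.
have [c [_ cc]] := @segment_compact R (- C) C (s @ U) sF UC.
exists c => B cB; have [//|UnB] := in_ultra_setVsetC (s @^-1` B) uU.
by have [x [nBx Bx]] := cc (~` B) B UnB cB.
Qed.

(** * Compactness along an ultrafilter *)

Section Compactness.
Context {X : E -> Prop} {f b : E -> E -> R}.
Hypotheses (sX : linsub X) (pf : psd X f).
Hypothesis fb : finite_rank_bound X f b.

(** Along U the finitely many functionals of [finite_rank_bound] converge, so a finite intersection
    of members of U makes all of them nearly constant; the remaining multiple of f is absorbed by
    the bound C. *)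
Lemma ultra_bounded_cauchy (U : set_system nat) (s : nat -> E) C e :
  UltraFilter U -> (forall n, X (s n)) -> (forall n, f (s n) (s n) <= C) -> 0 < e ->
  exists2 A, U A & forall i j, A i -> A j -> b (s i - s j) (s i - s j) <= e.
Proof.
move=> uU Xs sC e0.
have C0 : 0 <= C by rewrite (le_trans _ (sC 0%N))// (psd_ge0 pf).
(* As f (s i - s j) <= 4 C, this coefficient contributes at most e / 2; the added 1 covers C = 0. *)
have [|J [l [K [K0 lK bl]]]] := fb (e / (8 * (C + 1))).
  by rewrite divr_gt0//; lra.
have lB i x y : X x -> X y -> l i (x - y) = l i x - l i y.
  by move=> Xx Xy; rewrite addrC -scaleN1r (lK i).1//; ring.
have /choice[c cP] : forall i, exists c : R, l i (s n) @[n --> U] --> c.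
  move=> i; apply: (@ultra_cvg _ _ (K * C + 1)) => // k /=.
  have := (lK i).2 _ (Xs k); have : K * f (s k) (s k) <= K * C by rewrite ler_wpM2l.
  move=> H1 H2; have KC : 0 <= K * C by rewrite mulr_ge0.
  rewrite -ler_sqr ?nnegrE//; last by lra.
  by rewrite real_normK ?num_real//; rewrite !expr2 in H2 *; nra.
pose n := #|J|.
(* Two values this close in square to c i differ in square by at most e / (2 (n + 1)), and there are
   n functionals; n + 1 also serves an empty J. *)
pose A := [set k | forall i : J, (l i (s k) - c i) ^+ 2 <= e / (8 * n.+1%:R)].
have e'0 : 0 < e / (8 * n.+1%:R) by rewrite divr_gt0// mulr_gt0.
exists A.
  apply: filter_forall => i.
  have [d d0 dd] : exists2 d, 0 < d & d ^+ 2 <= e / (8 * n.+1%:R).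
    exists (Num.sqrt (e / (8 * n.+1%:R))); first by rewrite sqrtr_gt0.
    by rewrite sqr_sqrtr// ltW.
  have /cvgrPdist_le /(_ d d0) := cP i.
  apply: filterS => k /= H; apply: le_trans dd.
  by rewrite -real_normK ?num_real// ler_sqr ?nnegrE ?(ltW d0)// distrC.
move=> i j Ai Aj.
have Nij : f (s i - s j) (s i - s j) <= 4 * C.
  have := psd_quad_le2 sX pf _ _ (Xs i) (linsubZ _ (-1) _ sX (Xs j)).
  by rewrite (psd_quadZ sX pf)// scaleN1r; have := sC i; have := sC j; lra.
apply: (le_trans (bl _ (linsubB _ _ _ sX (Xs i) (Xs j)))).
have : e / (8 * (C + 1)) * f (s i - s j) (s i - s j) <= e / 2.
  apply: (@le_trans _ _ (e / (8 * (C + 1)) * (4 * C))).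
    by rewrite ler_wpM2l// divr_ge0//; lra.
  rewrite -subr_ge0 (_ : _ - _ = e / (2 * (C + 1))); last by field; lra.
  by rewrite divr_ge0//; lra.
suff : \sum_k l k (s i - s j) ^+ 2 <= e / 2 by lra.
apply: (@le_trans _ _ (\sum_(k : J) (e / (2 * n.+1%:R)))).
  apply: ler_sum => k _; rewrite lB//.
  have := Ai k; have := Aj k.
  have -> : e / (2 * n.+1%:R) = 4 * (e / (8 * n.+1%:R)) by field.
  move: (l k (s i)) (l k (s j)) (c k) (e / (8 * n.+1%:R)) => x y z r.
  have := sqr_ge0 ((x - z) + (y - z)); rewrite !expr2; nra.
rewrite sumr_const -[leLHS]mulr_natr -subr_ge0.
rewrite (_ : _ - _ = e / (2 * n.+1%:R)) ?divr_ge0 ?(ltW e0)//.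
have -> : n%:R = n.+1%:R - 1 :> R by rewrite -natr1 addrK.
by have := ltr0Sn R n; move: (n.+1%:R) => N N0; field; lra.
Qed.

(** Diagonal choice: k n is taken in the intersection of the first n + 1 Cauchy sets of one
    ultrafilter. That k n is at least n transfers tail bounds on s to the new sequence. *)
Lemma cauchy_subseq (s : nat -> E) C :
  (forall n, X (s n)) -> (forall n, f (s n) (s n) <= C) ->
  exists2 k : nat -> nat, forall n, (n <= k n)%N &
    forall n i j, (n <= i)%N -> (n <= j)%N ->
      b (s (k i) - s (k j)) (s (k i) - s (k j)) <= n.+1%:R^-1.
Proof.
move=> Xs sC.
have [U [uU ooU]] := ultraFilterLemma (@eventually_filter).
have /choice[A AP] : forall n : nat, exists A, U A /\ forall i j, A i -> A j ->
    b (s i - s j) (s i - s j) <= n.+1%:R^-1.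
  move=> n; have [|A UA HA] := ultra_bounded_cauchy U s C n.+1%:R^-1 uU Xs sC.
    by rewrite invr_gt0.
  by exists A.
have /choice[k kP] : forall n : nat, exists k, (n <= k)%N /\
    forall i, (i <= n)%N -> A i k.
  move=> n; have : U ([set k | (n <= k)%N] `&` [set k | forall i : 'I_n.+1, A i k]).
    apply: filterI; first by apply: ooU; exact: nbhs_infty_ge.
    by apply: filter_forall => i; exact: (AP i).1.
  move=> /filter_ex[k [nk Hk]]; exists k; split => // i iN.
  by have := Hk (Ordinal (iN : (i < n.+1)%N)).
exists k => [n|n i j ni nj]; first by case: (kP n).
by apply: (AP n).2; [apply: (kP i).2|apply: (kP j).2].
Qed.
End Compactness.

(** * Constrained Rayleigh minimisers and eigenvectors *)

Section Spectrum.
Context {X : E -> Prop} {a0 b p : E -> E -> R} {K : R}.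
Hypotheses (sX : linsub X) (pa0 : psd X a0) (pb : psd X b) (pp : psd X p).
Hypothesis pK : forall x, X x -> p x x <= K * b x x.
Hypothesis K0 : 0 <= K.
Let f := form_add a0 b.
Hypotheses (cX : seq_complete X f) (fb : finite_rank_bound X f b).
Let a := form_add a0 p.

Let pa : psd X a. Proof. exact: psd_add. Qed.
Let pf : psd X f. Proof. exact: psd_add. Qed.

(** One statement serves both eigenvalues: w = 0 makes the constraint void, and w a first
    eigenvector yields the second one. Compactness makes a minimising sequence b-Cauchy, minimality
    then makes it f-Cauchy, and normalisation and constraint are b-continuous. *)
Lemma rayleigh_minimizer w : X w -> (exists y, [/\ X y, b y w = 0 & 0 < b y y]) ->
  exists x, [/\ X x, b x w = 0, b x x = 1 &
    forall y, X y -> b y w = 0 -> a x x * b y y <= a y y].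
Proof.
move=> Xw [y0 [Xy0 y0w y0p]].
pose P x := [/\ X x, b x w = 0 & b x x = 1].
pose S := [set a x x | x in P].
have norml x : X x -> b x w = 0 -> 0 < b x x -> P ((Num.sqrt (b x x))^-1 *: x).
  move=> Xx xw x0; split; first exact: linsubZ.
    by rewrite (psdZl sX pb)// xw mulr0.
  by rewrite (psd_quadZ sX pb)// exprVn sqr_sqrtr ?(ltW x0)// mulVf// gt_eqF.
have hS : has_inf S.
  split; first by eexists; eexists; [exact: (norml y0)|].
  by exists 0 => _ [x [Xx _ _] <-]; exact: (psd_ge0 pa).
pose L := inf S.
have L0 : 0 <= L by apply: lb_le_inf; [exact: hS.1|move=> _ [x [Xx _ _] <-]; exact: (psd_ge0 pa)].
have Linf x : X x -> b x w = 0 -> L * b x x <= a x x.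
  move=> Xx xw; have := psd_ge0 pb _ Xx; rewrite le_eqVlt => /predU1P[<-|x0].
    by rewrite mulr0 (psd_ge0 pa).
  have : L <= a ((Num.sqrt (b x x))^-1 *: x) ((Num.sqrt (b x x))^-1 *: x).
    by apply: ge_inf; [exact: hS.2|eexists; [exact: (norml x)|]].
  by rewrite (psd_quadZ sX pa)// exprVn sqr_sqrtr ?(ltW x0)// [_^-1 * _]mulrC ler_pdivlMr.
have /choice[s Hs] : forall n : nat, exists x, P x /\ a x x < L + n.+1%:R^-1.
  move=> n; have [|_ [x Xx <-] Hx] := @inf_adherent _ S n.+1%:R^-1 _ hS.
    by rewrite invr_gt0.
  by exists x.
have Xs n : X (s n) by case: (Hs n) => -[].
have a0a x : X x -> a0 x x <= a x x.
  by move=> Xx; rewrite /a /form_add lerDl (psd_ge0 pp).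
have fs n : f (s n) (s n) <= L + 2.
  have [[_ _ b1] sn] := Hs n; rewrite /f /form_add b1.
  have := a0a _ (Xs n); have : n.+1%:R^-1 <= 1 :> R by rewrite invf_le1// ler1n.
  by move: (n.+1%:R^-1) sn => *; lra.
have [k kn kc] := cauchy_subseq sX pf fb _ _ Xs fs.
pose t n := s (k n).
have Xt n : X (t n) by exact: Xs.
have at1 n i : (n <= i)%N -> a (t i) (t i) < L + n.+1%:R^-1.
  move=> ni; have [_ H] := Hs (k i); apply: (lt_le_trans H).
  by rewrite lerD2l lef_pV2 ?posrE// ler_nat ltnS (leq_trans ni).
(* By the parallelogram identity a (t i - t j) <= 4 L + 4 / (n + 1) - L b (t i + t j), where b (t i
   + t j) = 4 - b (t i - t j). This gives (4 + L) / (n + 1) for a0, and b adds one more 1 / (n +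
   1). *)
have ac n i j : (n <= i)%N -> (n <= j)%N ->
    f (t i - t j) (t i - t j) <= (5 + L) * n.+1%:R^-1.
  move=> ni nj; have := kc n i j ni nj; rewrite -/(t i) -/(t j).
  have [[_ bi0 bi] _] := Hs (k i); have [[_ bj0 bj] _] := Hs (k j).
  have Xij := linsubD _ _ _ sX (Xt i) (Xt j).
  have := Linf _ Xij; rewrite (psdDl pb)//.
  rewrite bi0 bj0 addr0 => /(_ erefl).
  have := a0a _ (linsubB _ _ _ sX (Xt i) (Xt j)).
  have := at1 n i ni; have := at1 n j nj.
  rewrite /f /form_add.
  rewrite (psd_quadB sX pb)// (psd_quadB sX pa)// (psd_quadD sX pb)// (psd_quadD sX pa)//.
  rewrite bi bj; move: (b (t i) (t j)) (a (t i) (t j)) (a (t i) (t i)) (a (t j) (t j)) (n.+1%:R^-1).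
  move: (a0 (t i - t j) (t i - t j)) => A B C D F G *.
  nra.
have [e e0|x Xx cx] := cX t Xt.
  have [|n0 Hn0] := small_invS (e / (5 + L)); first by rewrite divr_gt0//; lra.
  exists n0 => i j ni nj; apply: (le_trans (ac _ _ _ ni nj)).
  by rewrite mulrC -ler_pdivlMr; [exact: Hn0|lra].
have cb : (fun n => b (t n - x) (t n - x)) @ \oo --> 0.
  apply: (squeeze_cvgr _ (cvg_cst 0) cx); apply: nearW => n /=.
  have Xtx := linsubB _ _ _ sX (Xt n) Xx.
  by rewrite (psd_ge0 pb)//= /f /form_add lerDr (psd_ge0 pa0).
have ca : (fun n => a (t n - x) (t n - x)) @ \oo --> 0.
  have cKx : (fun n => (1 + K) * f (t n - x) (t n - x)) @ \oo --> 0.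
    by rewrite -[X in _ --> X](mulr0 (1 + K)); apply: cvgM => //; exact: cvg_cst.
  apply: (squeeze_cvgr _ (cvg_cst 0) cKx); apply: nearW => n /=.
  have Xtx := linsubB _ _ _ sX (Xt n) Xx.
  rewrite (psd_ge0 pa)//= /f /a /form_add.
  have := pK _ Xtx; have := psd_ge0 pa0 _ Xtx; have := psd_ge0 pb _ Xtx.
  move: (a0 _ _) (b _ _) (p _ _) => A B C B0 A0 CB.
  by have := mulr_ge0 K0 A0; nra.
have bx1 : b x x = 1.
  have := psd_cvg_quad sX pb _ _ Xt Xx cb.
  have -> : (fun n => b (t n) (t n)) = cst 1.
    by apply/funext => n; have [[]] := Hs (k n).
  by move=> /(cvg_lim (@Rhausdorff R)) <-; exact: lim_cst.
have bxw : b x w = 0.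
  have := psd_cvg0 sX pb _ _ _ Xt Xx Xw cb.
  have -> : (fun n => b (t n) w) = cst 0.
    by apply/funext => n; have [[]] := Hs (k n).
  by move=> /(cvg_lim (@Rhausdorff R)) <-; exact: lim_cst.
exists x; split => // y Xy yw.
have aL : a x x <= L.
  have c1 := psd_cvg_quad sX pa _ _ Xt Xx ca.
  have c2 : (fun n => L + n.+1%:R^-1) @ \oo --> L.
    rewrite -[X in _ --> X]addr0; apply: cvgD; first exact: cvg_cst.
    exact: cvg_harmonic.
  by apply: (ler_cvg_to c1 c2); apply: nearW => n; apply: ltW; exact: at1.
by apply: le_trans (Linf y Xy yw); rewrite ler_wpM2r// (psd_ge0 pb).
Qed.

(** Positive mass, rather than x != 0, excludes null vectors; it is the abstract form of not
    vanishing almost everywhere. *)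
Definition eigvec l x :=
  [/\ X x, 0 < b x x & forall y, X y -> a x y = l * b x y].

Lemma eigvec_quad l x : eigvec l x -> a x x = l * b x x.
Proof. by case=> Xx _; exact. Qed.

Lemma eigvec_orth l l' x y : eigvec l x -> eigvec l' y -> l != l' -> b x y = 0.
Proof.
move=> [Xx _ Hx] [Xy _ Hy] ll'; have := Hx y Xy; have := Hy x Xx.
rewrite (psdC pa y x)// (psdC pb y x)// => -> H; apply/eqP.
have : (l - l') * b x y = 0 by rewrite mulrBl -H subrr.
by move/eqP; rewrite mulf_eq0 subr_eq0 (negPf ll').
Qed.

(** Varying x inside the b-complement of w gives the Euler-Lagrange equation only against that
    complement. It extends to all of X because w satisfies an eigenvalue equation, whence a x w =
    0. *)
Lemma minimizer_eigvec w x : X w -> w = 0 \/ b w w = 1 ->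
  (forall y, X y -> a w y = a w w * b w y) ->
  X x -> b x w = 0 -> b x x = 1 ->
  (forall y, X y -> b y w = 0 -> a x x * b y y <= a y y) -> eigvec (a x x) x.
Proof.
move=> Xw w01 ew Xx xw x1 xmin; split => //; first by rewrite x1.
have H y : X y -> b y w = 0 -> a x y = a x x * b x y.
  move=> Xy yw; apply/eqP; rewrite -subr_eq0; apply/eqP.
  apply: (@small_quad _ (a y y - a x x * b y y)) => t.
  have Xty := sX.2 t y x Xy Xx.
  have := xmin _ Xty; rewrite (psdl pb)// yw xw mulr0 addr0 => /(_ erefl).
  rewrite (psd_quad sX pb)// (psd_quad sX pa)// (psdC pa y)// (psdC pb y)// x1.
  by move: (a x y) (b x y) (a y y) (b y y) (a x x) => *; nra.
move=> y Xy; have awx : a w x = 0 by rewrite ew// (psdC pb w)// xw mulr0.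
(* Projection of y off w; for w = 0 it is y itself. *)
have Xy' := sX.2 (- b y w) w y Xw Xy.
have y'0 : b (- b y w *: w + y) w = 0.
  rewrite (psdl pb)//; case: w01 => ->; last by ring.
  by rewrite (psdC pb y)// ?(psd0l sX pb)// ?mulr0 ?addr0//; exact: sX.1.
have := H _ Xy' y'0; rewrite (psdr sX pa)// (psdr sX pb)// xw (psdC pa x w)// awx.
by rewrite !mulr0 !add0r.
Qed.
End Spectrum.
End Forms.

(** * The spectral gap *)

Section Gap.
Context {R : realType} {E : lmodType R}.
Context {X : E -> Prop} {a0 b : E -> E -> R} {K : R}.
Hypotheses (sX : linsub X) (pa0 : psd X a0) (pb : psd X b) (K0 : 0 <= K).
Hypotheses (cX : seq_complete X (form_add a0 b))
  (fb : finite_rank_bound X (form_add a0 b) b).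

(** From here to [gap]: transcriptions of [eigenvalue], [lambda1], [mult_ge2], [lambda2] and
    [Gamma], with the same value 0 of [inf] on the empty set, so that [GammaE] only has to compare
    sets. *)
Definition spec p := [set l | exists x, eigvec (X := X) (a0 := a0) (b := b) (p := p) l x].
Definition first_eig p := inf (spec p).
Definition double_eig p l := exists x y,
  [/\ eigvec (X := X) (a0 := a0) (b := b) (p := p) l x,
      eigvec (X := X) (a0 := a0) (b := b) (p := p) l y
    & forall s t : R, b (s *: x + t *: y) (s *: x + t *: y) = 0 -> s = 0 /\ t = 0].
Definition second_eig p := if `[< double_eig p (first_eig p) >] then first_eig p
  else inf [set l | spec p l /\ first_eig p < l].
Definition gap p := second_eig p - first_eig p.

Definition orthonormal_pair x y := [/\ X x, X y & [/\ b x x = 1, b y y = 1 & b x y = 0]].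

(** K is common to the whole family of potentials; this makes the later estimates uniform in p. *)
Definition perturbation p := psd X p /\ forall x, X x -> p x x <= K * b x x.

(** Eigenvectors have positive mass, so both infima range over the empty set and equal 0. *)
Lemma gap_trivial p : (forall x, X x -> b x x = 0) -> gap p = 0.
Proof.
move=> b0.
have s0 : spec p = set0.
  by apply/seteqP; split => // l [x [Xx]]; rewrite b0// ltxx.
rewrite /gap /second_eig /first_eig s0 inf0.
case: asboolP => [[x [y [[Xx x0 _] _ _]]]|_]; first by move: x0; rewrite b0// ltxx.
by rewrite (_ : [set l | _] = set0) ?inf0 ?subrr//; apply/seteqP; split => // l [].
Qed.

Lemma normalize_pair x y : X x -> X y -> b x x = 1 -> b y x = 0 -> 0 < b y y ->
  orthonormal_pair x ((Num.sqrt (b y y))^-1 *: y).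
Proof.
move=> Xx Xy x1 yx y0; split => //; first exact: linsubZ.
split => //.
  by rewrite (psd_quadZ sX pb)// exprVn sqr_sqrtr ?(ltW y0)// mulVf// gt_eqF.
by rewrite (psdC pb)// ?(psdZl sX pb)// ?yx ?mulr0//; exact: linsubZ.
Qed.

Section OneForm.
Variable p : E -> E -> R.
Hypothesis pP : perturbation p.
Let a := form_add a0 p.
Let pa : psd X a. Proof. by apply: psd_add => //; exact: pP.1. Qed.
Let eig l x := eigvec (X := X) (a0 := a0) (b := b) (p := p) l x.

(** The Rayleigh minimum is an eigenvalue, and every eigenvalue is the Rayleigh quotient of its
    eigenvector. *)
Lemma first_eigP : (exists2 x, X x & 0 < b x x) ->
  exists x, [/\ b x x = 1, eig (a x x) x, first_eig p = a x x &
    forall y, X y -> a x x * b y y <= a y y].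
Proof.
move=> [x0 Xx0 x0p]; have X0 : X 0 := sX.1.
have b0 y : X y -> b y 0 = 0 by move=> Xy; rewrite (psdC pb)// (psd0l sX pb).
have [|x [Xx x0w x1 xmin]] := rayleigh_minimizer sX pa0 pb pP.1 pP.2 K0 cX fb 0 X0.
  by exists x0; split => //; exact: b0.
have ex : eig (a x x) x.
  apply: (minimizer_eigvec sX pa0 pb pP.1 0 x X0) => //; first by left.
  by move=> y Xy; rewrite -/a !(psd0l sX pa)// mul0r.
have xmin' y : X y -> a x x * b y y <= a y y by move=> Xy; apply: xmin => //; exact: b0.
exists x; split => //.
have lbs : lbound (spec p) (a x x).
  move=> l [y ey]; have [Xy y0 _] := ey.
  have := xmin' y Xy; rewrite /a (eigvec_quad _ _ ey) ler_pM2r//.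
apply/eqP; rewrite eq_le; apply/andP; split.
  by apply: ge_inf; [exists (a x x)|exists x].
by apply: lb_le_inf => //; exists (a x x), x.
Qed.

(** Everything b-orthogonal to a first eigenvector has zero mass, so there is no second eigenvalue
    and the second infimum is 0, that of the empty set. *)
Lemma gap_line : (exists2 x, X x & 0 < b x x) ->
  ~ (exists x y, orthonormal_pair x y) -> gap p = - first_eig p.
Proof.
move=> /first_eigP[x [x1 ex l1 xmin]] np; have [Xx _ exx] := ex.
have orth0 y : X y -> b y x = 0 -> b y y = 0.
  move=> Xy yx; apply/eqP; apply: contra_notT np => y0; exists x; eexists.
  apply: (normalize_pair _ y) => //.
  by rewrite lt_neqAle eq_sym y0 (psd_ge0 pb).
rewrite /gap /second_eig; case: asboolP => [[u [v [eu ev uv]]]|_].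
  exfalso; have [Xu u0 _] := eu; have [Xv v0 _] := ev.
  (* This combination is b-orthogonal to x, hence null; independence gives b v x = 0, and then v
     would be null. *)
  have Xuv : X (b v x *: u + - b u x *: v) by apply: sX.2 => //; exact: linsubZ.
  have /uv[vx0 _] : b (b v x *: u + - b u x *: v) (b v x *: u + - b u x *: v) = 0.
    apply: orth0 => //; rewrite (psdl pb)//; last exact: linsubZ.
    by rewrite (psdZl sX pb)//; ring.
  by move: v0; rewrite (orth0 v)// ltxx.
rewrite (_ : [set l | _] = set0) ?inf0 ?sub0r//; apply/seteqP; split => // l [[y ey]].
rewrite l1 => xl; have [Xy y0 _] := ey.
have := eigvec_orth pa0 pb pP.1 _ _ _ _ ey ex.
rewrite gt_eqF// => /(_ erefl) yx.
by move: y0; rewrite orth0// ltxx.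
Qed.

(** y minimises over the b-complement of x, and a y y is the second eigenvalue whether or not the
    first is double. The last clause is the Ky Fan trace inequality for pairs. *)
Lemma gap_plane : (exists x y, orthonormal_pair x y) ->
  exists x y, [/\ orthonormal_pair x y, gap p = a y y - a x x, a x x <= a y y,
    forall z, X z -> a x x * b z z <= a z z &
    forall z z', orthonormal_pair z z' -> a x x + a y y <= a z z + a z' z'].
Proof.
move=> [u [v [Xu Xv [u1 v1 uv]]]].
have [|x [x1 ex l1 xmin]] := first_eigP; first by exists u => //; rewrite u1.
have [Xx _ exx] := ex.
have [|y [Xy yx y1 ymin]] := rayleigh_minimizer sX pa0 pb pP.1 pP.2 K0 cX fb x Xx.
  (* The plane of u and v contains a non-null vector orthogonal to x: w in general, u itself when
     both coefficients vanish. *)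
  pose w := b v x *: u + (- b u x) *: v.
  have Xw : X w by apply: sX.2 => //; exact: linsubZ.
  have wx : b w x = 0.
    by rewrite (psdl pb)// ?(psdZl sX pb)//; [ring|exact: linsubZ].
  have ww : b w w = b v x ^+ 2 + b u x ^+ 2.
    rewrite /w (psd_quad sX pb)//; last exact: linsubZ.
    rewrite (psd_quadZ sX pb)// (psdC pb u)//; last exact: linsubZ.
    by rewrite (psdZl sX pb)// (psdC pb v u)// uv u1 v1; ring.
  have [w0|w0] := eqVneq (b w w) 0; last first.
    by exists w; split => //; rewrite lt_neqAle eq_sym w0 (psd_ge0 pb).
  exists u; split => //; last by rewrite u1.
  apply/eqP; rewrite -sqrf_eq0 eq_le sqr_ge0 andbT.
  by rewrite -w0 ww lerDr sqr_ge0.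
have ey : eig (a y y) y.
  by apply: (minimizer_eigvec sX pa0 pb pP.1 x y Xx) => //; right.
have xy : a x x <= a y y by have := xmin y Xy; rewrite y1 mulr1.
have byx : b x y = 0 by rewrite (psdC pb).
exists x, y; split => //.
  rewrite /gap l1; congr (_ - _); rewrite /second_eig l1; case: asboolP => [D|D].
    apply/eqP; rewrite eq_le xy /=.
    have [s [t [es et st]]] := D; have [Xs s0 _] := es; have [Xt t0 _] := et.
    (* A two-dimensional eigenspace contains a non-null vector b-orthogonal to x; its Rayleigh
       quotient a x x bounds the minimum a y y from above. *)
    pose w := b t x *: s + (- b s x) *: t.
    have Xw : X w by apply: sX.2 => //; exact: linsubZ.
    have wx : b w x = 0.
      by rewrite (psdl pb)// ?(psdZl sX pb)//; [ring|exact: linsubZ].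
    have aw : a w w = a x x * b w w.
      have aw z : X z -> a w z = a x x * b w z.
        move=> Xz; rewrite (psdl pa)// ?(psdl pb)//; [|exact: linsubZ..].
        rewrite (psdZl sX pa)// (psdZl sX pb)//.
        by have [_ _ Hs] := es; have [_ _ Ht] := et; rewrite /a Hs// Ht// -/a; ring.
      exact: aw.
    have [w0|w0] := eqVneq (b w w) 0.
      have [tx0 /eqP] := st _ _ w0; rewrite oppr_eq0 => /eqP sx0.
      have := ymin s Xs sx0; rewrite (eigvec_quad _ _ es).
      by rewrite ler_pM2r.
    have := ymin w Xw wx; rewrite -/a aw ler_pM2r//.
    by rewrite lt_neqAle eq_sym w0 (psd_ge0 pb).
  (* Equality would make x and y independent eigenvectors for the first eigenvalue. *)
  have lxy : a x x < a y y.
    rewrite lt_neqAle xy andbT; apply/eqP => xye; apply: D.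
    exists x, y; split => //; first by rewrite xye.
    move=> s t; rewrite (psd_quad sX pb)//; last exact: linsubZ.
    rewrite (psd_quadZ sX pb)// (psdC pb x)//; last exact: linsubZ.
    rewrite (psdZl sX pb)// yx x1 y1 !mulr0 addr0 !mulr1 => /eqP.
    by rewrite paddr_eq0 ?sqr_ge0// !sqrf_eq0 => /andP[/eqP-> /eqP->].
  have H : [set l | spec p l /\ a x x < l] (a y y) by split => //; exists y.
  have lbs : lbound [set l | spec p l /\ a x x < l] (a y y).
    move=> l [[z ez] xl]; have [Xz z0 _] := ez.
    have zx : b z x = 0 by apply: (eigvec_orth pa0 pb pP.1 _ _ _ _ ez ex); rewrite gt_eqF.
    by have := ymin z Xz zx; rewrite (eigvec_quad _ _ ez) ler_pM2r.
  apply/eqP; rewrite eq_le; apply/andP; split.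
    by apply: ge_inf => //; exists (a y y).
  by apply: lb_le_inf => //; exists (a y y).
(* rotate the pair so that its second vector is orthogonal to x; the trace of
   the form on the plane is invariant *)
move=> z z' [Xz Xz' [z1 z'1 zz']].
pose c := b z x; pose s := b z' x.
(* If z and z' are both orthogonal to x there is nothing to rotate: z is compared with x and z' with
   y. *)
have [cs0|cs0] := eqVneq (c ^+ 2 + s ^+ 2) 0.
  have /andP[_ /eqP s0] : (c == 0) && (s == 0).
    by rewrite -(sqrf_eq0 c) -(sqrf_eq0 s) -paddr_eq0 ?sqr_ge0//; apply/eqP.
  have := xmin z Xz; have := ymin z' Xz' s0; rewrite z1 z'1 !mulr1 -/a; lra.
have r0 : 0 < c ^+ 2 + s ^+ 2 by rewrite lt_neqAle eq_sym cs0 addr_ge0 ?sqr_ge0.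
have Xsz : X (s *: z') by exact: linsubZ.
have Xcz : X (c *: z') by exact: linsubZ.
have Xw1 : X (c *: z + s *: z') by exact: sX.2.
have Xw2 : X (- s *: z + c *: z') by exact: sX.2.
(* Both rotated vectors have mass c^2 + s^2, and the cross terms cancel in the sum of their
   a-values; the common factor is cancelled at the end. *)
have := xmin _ Xw1; have := ymin _ Xw2.
rewrite (psdl pb)// (psdZl sX pb)// -/c -/s.
rewrite (_ : - s * c + c * s = 0); last by ring.
move=> /(_ erefl).
rewrite -/a !(psd_quad sX pb)// !(psd_quad sX pa)//.
rewrite !(psd_quadZ sX pb)// !(psd_quadZ sX pa)//.
rewrite !(psdC pb z)// !(psdC pa z (_ *: _))//.
rewrite !(psdZl sX pb)// !(psdZl sX pa)//.
rewrite (psdC pb z' z)// zz' z1 z'1 => H1 H2.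
rewrite -(ler_pM2l r0).
move: H1 H2; clear.
move: (a x x) (a y y) (a z z) (a z' z') (a z' z) c s => A B C D F c s H1 H2; lra.
Qed.
End OneForm.
End Gap.

(** * Semicontinuity of the gap and existence of a minimiser *)

Section GapMinimizer.
Context {R : realType} {E : lmodType R}.
Context {X : E -> Prop} {a0 b : E -> E -> R} {K : R}.
Hypotheses (sX : linsub X) (pa0 : psd X a0) (pb : psd X b) (K0 : 0 <= K).
Hypotheses (cX : seq_complete X (form_add a0 b))
  (fb : finite_rank_bound X (form_add a0 b) b).
Context {I : Type} {S : I -> Prop} {P : I -> E -> E -> R}.
Hypothesis P_pert : forall V, S V -> perturbation (X := X) (b := b) (K := K) (P V).
Hypothesis P_compact : forall (V : nat -> I) (U : set_system nat),
  (forall n, S (V n)) -> UltraFilter U ->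
  exists2 W, S W & forall x, X x -> P (V n) x x @[n --> U] --> P W x x.

(* Pointwise convergence of the forms is uniform on energy-bounded sequences,
   because these are b-Cauchy along the ultrafilter. *)
Lemma perturbation_lsc (V : nat -> I) (W : I) (U : set_system nat)
    (s : nat -> E) (C e : R) :
  UltraFilter U -> (forall n, S (V n)) -> S W ->
  (forall x, X x -> P (V n) x x @[n --> U] --> P W x x) ->
  (forall n, X (s n)) -> (forall n, form_add a0 b (s n) (s n) <= C) -> 0 < e ->
  U [set n | P W (s n) (s n) <= P (V n) (s n) (s n) + e].
Proof.
move=> uU SV SW VW Xs sC e0.
have C0 : 0 <= C.
  by rewrite (le_trans _ (sC 0%N))// addr_ge0 ?(psd_ge0 pa0)// (psd_ge0 pb).
(* With b (s i - s j) <= (e / 3)^2 / D and b (s i + s j) <= 4 C, the product of the two bounds K b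
   stays below (e / 3)^2. *)
pose D := 4 * K ^+ 2 * C + 1.
have D0 : 0 < D by rewrite ltr_pwDr// mulr_ge0// mulr_ge0// sqr_ge0.
have pf : psd X (form_add a0 b) by exact: psd_add.
have [|A UA HA] := ultra_bounded_cauchy sX pf fb U s C ((e / 3) ^+ 2 / D) uU Xs sC.
  by rewrite divr_gt0// exprn_gt0//; lra.
have [l Al] := filter_ex UA.
have bC n : b (s n) (s n) <= C.
  by apply: le_trans (sC n); rewrite /form_add lerDr (psd_ge0 pa0).
have osc Z i j : S Z -> A i -> A j -> `|P Z (s i) (s i) - P Z (s j) (s j)| <= e / 3.
  move=> SZ Ai Aj; have [pZ ZK] := P_pert Z SZ.
  have XB := linsubB _ _ _ sX (Xs i) (Xs j).
  have XD := linsubD _ _ _ sX (Xs i) (Xs j).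
  rewrite -ler_sqr ?nnegrE//; last by rewrite divr_ge0// ltW.
  rewrite real_normK ?num_real//; apply: (le_trans (psd_quad_diff sX pZ _ _ (Xs i) (Xs j))).
  have [z1 z2] := (psd_ge0 pZ _ XB, psd_ge0 pZ _ XD).
  have k1 := ZK _ XB; have k2 := ZK _ XD.
  have b2 := psd_quad_le2 sX pb _ _ (Xs i) (Xs j).
  have b2' : b (s i + s j) (s i + s j) <= 4 * C by have := bC i; have := bC j; lra.
  have b1 := HA i j Ai Aj.
  have k1' : P Z (s i - s j) (s i - s j) <= K * ((e / 3) ^+ 2 / D).
    by apply: (le_trans k1); rewrite ler_wpM2l.
  have k2' : P Z (s i + s j) (s i + s j) <= K * (4 * C).
    by apply: (le_trans k2); rewrite ler_wpM2l.
  apply: (le_trans (ler_pM z1 z2 k1' k2')).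
  rewrite -subr_ge0 (_ : _ - _ = (e / 3) ^+ 2 / D); last first.
    by rewrite /D; field; move: D0; rewrite /D; lra.
  by rewrite divr_ge0 ?sqr_ge0// ltW.
have e30 : 0 < e / 3 by rewrite divr_gt0.
(* Three errors of e / 3 lead from P W (s n) to P W (s l), to P (V n) (s l), to P (V n) (s n), with
   one fixed index l in A; pointwise convergence is used only at s l. *)
have UB : U [set n | `|P W (s l) (s l) - P (V n) (s l) (s l)| <= e / 3].
  by have /cvgrPdist_le/(_ _ e30) := VW _ (Xs l).
apply: filterS (filterI UA UB) => n [An /= Bn].
have := osc W n l SW An Al; have := osc (V n) l n (SV n) Al An.
rewrite !ler_norml in Bn *.
by move=> /andP[? ?] /andP[? ?]; move/andP: Bn => [? ?]; lra.
Qed.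

Notation gapP V := (gap (X := X) (a0 := a0) (b := b) (P V)).

(** A trial vector that does not vary with n needs only pointwise convergence; a minimiser of W as x
    gives upper semicontinuity of [first_eig]. *)
Lemma first_eig_usc V W (U : set_system nat) x e : UltraFilter U ->
  (forall x, X x -> P (V n) x x @[n --> U] --> P W x x) -> X x -> 0 < e ->
  U [set n | form_add a0 (P (V n)) x x <= form_add a0 (P W) x x + e].
Proof.
move=> uU VW Xx e0.
have /cvgrPdist_le/(_ _ e0) := VW _ Xx; apply: filterS => n /=.
by rewrite /form_add ler_norml => /andP[? ?]; lra.
Qed.

Lemma gap_minimizer : (exists V, S V) ->
  exists2 W, S W & gapP W = inf [set gapP V | V in S].
Proof.
move=> [V0 SV0].
have [b0|] := pselect (forall x, X x -> b x x = 0).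
  exists V0 => //; rewrite gap_trivial//.
  rewrite (_ : [set _ | _ in _] = [set 0]) ?inf1//.
  apply/seteqP; split => [_ [V _ <-]|_ ->] /=; first by rewrite gap_trivial.
  by exists V0 => //; rewrite gap_trivial.
move=> /existsNP[x0 /not_implyP[Xx0 /eqP x0n]].
have [U [uU ooU]] := ultraFilterLemma (@eventually_filter).
have x0p : exists2 x, X x & 0 < b x x.
  by exists x0 => //; rewrite lt_neqAle eq_sym x0n (psd_ge0 pb).
have first V (SV : S V) := first_eigP sX pa0 pb K0 cX fb (P V) (P_pert V SV) x0p.
(* it suffices to bound the gap below and to prove lower semicontinuity along
   a minimising sequence *)
suff [[B HB] H] : (exists B, forall V, S V -> B <= gapP V) /\
    (forall (V : nat -> I) W e, (forall n, S (V n)) -> S W ->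
      (forall x, X x -> P (V n) x x @[n --> U] --> P W x x) -> 0 < e ->
      U [set n | gapP W <= gapP (V n) + e]).
  pose T := [set gapP V | V in S].
  have hT : has_inf T.
    by split; [exists (gapP V0), V0|exists B => _ [V SV <-]; exact: HB].
  have /choice[V HV] : forall n : nat, exists V, S V /\ gapP V < inf T + n.+1%:R^-1.
    move=> n; have [|_ [V SV <-] ?] := @inf_adherent _ T n.+1%:R^-1 _ hT.
      by rewrite invr_gt0.
    by exists V.
  have SV n : S (V n) by case: (HV n).
  have [W SW VW] := P_compact V U SV uU.
  exists W => //; apply/eqP; rewrite eq_le; apply/andP; split; last first.
    by apply: ge_inf; [exact: hT.2|exists W].
  apply/ler_addgt0Pr => e e0.
  have e2 : 0 < e / 2 by rewrite divr_gt0.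
  have [n0 Hn0] := small_invS (e / 2) e2.
  have Un0 : U [set n | (n0 <= n)%N] by apply: ooU; exact: nbhs_infty_ge.
  have [n [n0n /= Hn]] := filter_ex (filterI Un0 (H V W (e / 2) SV SW VW e2)).
  have [_] := HV n; have := Hn0 n n0n; rewrite -/T in Hn *; move: Hn.
  by move: (gapP _) (gapP _) (inf T) (n.+1%:R^-1) => *; lra.
have [[x [y xy]]|np] := pselect (exists x y, orthonormal_pair (X := X) (b := b) x y).
  have plane V (SV : S V) : _ :=
    gap_plane sX pa0 pb K0 cX fb (P V) (P_pert V SV) (ex_intro _ x (ex_intro _ y xy)).
  split.
    by exists 0 => V SV; have [z [z' [_ -> ? _ _]]] := plane V SV; rewrite subr_ge0.
  move=> V W e SV SW VW e0.
  (* One error for each vector of the trial pair, and twice the error of lambda_1. *)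
  have e4 : 0 < e / 4 by rewrite divr_gt0.
  have /choice[z Hz] : forall n, exists z, exists z',
     [/\ orthonormal_pair (X := X) (b := b) z z',
       gapP (V n) = form_add a0 (P (V n)) z' z' - form_add a0 (P (V n)) z z,
       form_add a0 (P (V n)) z z <= form_add a0 (P (V n)) z' z',
       forall t, X t -> form_add a0 (P (V n)) z z * b t t <= form_add a0 (P (V n)) t t &
       forall t t', orthonormal_pair (X := X) (b := b) t t' ->
         form_add a0 (P (V n)) z z + form_add a0 (P (V n)) z' z'
         <= form_add a0 (P (V n)) t t + form_add a0 (P (V n)) t' t'].
    by move=> n; exact: plane.
  have /choice[z' Hz'] := Hz.
  have [w [w' [[Xw Xw' [w1 w'1 ww']] -> _ wmin wmin2]]] := plane W SW.
  have Xz n : X (z n) by have [[]] := Hz' n.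
  have Xz' n : X (z' n) by have [[]] := Hz' n.
  have [Xx Xy [x1 y1 xy0]] := xy.
  (* The trace of V n is at most its value on the fixed pair x, y, hence at most a0 x x + a0 y y + 2
     K; the last 1 is the mass of a normalised vector. *)
  pose C := a0 x x + a0 y y + 2 * K + 1.
  have zC n : form_add a0 b (z n) (z n) <= C /\ form_add a0 b (z' n) (z' n) <= C.
    have [[_ _ [z1 z'1 _]] _ _ _ /(_ _ _ xy)] := Hz' n.
    have [pV VK] := P_pert _ (SV n).
    have := VK _ Xx; have := VK _ Xy; rewrite x1 y1 /form_add z1 z'1 /C.
    have := psd_ge0 pV _ (Xz n); have := psd_ge0 pV _ (Xz' n).
    have := psd_ge0 pa0 _ (Xz n); have := psd_ge0 pa0 _ (Xz' n).
    by move=> *; split; lra.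
  have U1 := perturbation_lsc V W U z C _ uU SV SW VW Xz (fun n => (zC n).1) e4.
  have U2 := perturbation_lsc V W U z' C _ uU SV SW VW Xz' (fun n => (zC n).2) e4.
  have U3 := first_eig_usc V W U w _ uU VW Xw e4.
  apply: filterS (filterI (filterI U1 U2) U3) => n [[/= h1 h2] /= h3].
  have [zz' -> _ zmin _] := Hz' n.
  have := wmin2 _ _ zz'; have := zmin w Xw; rewrite w1 mulr1.
  rewrite /form_add in h3 *.
  by move=> *; lra.
(* Now the gap is - lambda_1: a fixed trial vector bounds it below, and its lower semicontinuity is
   the upper semicontinuity of lambda_1. *)
have line V (SV : S V) := gap_line sX pa0 pb K0 cX fb (P V) (P_pert V SV) x0p np.
split.
  have [x [x1 [Xx _ _] _ _]] := first V0 SV0.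
  exists (- (a0 x x + K)) => V SV; rewrite line// lerN2.
  have [z [z1 _ -> /(_ x Xx)]] := first V SV; rewrite x1 mulr1.
  have [_ /(_ x Xx)] := P_pert V SV; rewrite x1 /form_add.
  by move=> *; lra.
move=> V W e SV SW VW e0; rewrite line//.
have [x [x1 [Xx _ _] -> _]] := first W SW.
apply: filterS (first_eig_usc V W U x e uU VW Xx e0) => n /=.
rewrite line//; have [z [z1 _ -> /(_ x Xx)]] := first (V n) (SV n).
by rewrite x1 mulr1; move=> *; lra.
Qed.
End GapMinimizer.

(** * Square-integrable functions *)

Section SquareIntegrable.
Context {d : measure_display} {T : measurableType d} {R : realType}.
Context {mu : measure T R} {D : set T}.
Hypothesis mD : measurable D.

(** Measure and domain are left general: the square, its cells and segments of the line all
    occur. *)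
Definition sqint (f : T -> R) :=
  measurable_fun D f /\ (\int[mu]_(x in D) ((f x) ^+ 2)%:E < +oo)%E.

Definition ip (f g : T -> R) := Rintegral mu D (fun x => f x * g x).

Lemma sqint_sqr_integrable f : sqint f -> mu.-integrable D (fun x => (f x ^+ 2)%:E).
Proof.
move=> [mf foo]; apply/integrableP; split.
  by apply/measurable_EFinP; exact: measurable_funX.
rewrite (eq_integral (fun x => (f x ^+ 2)%:E))// => x _.
by rewrite gee0_abs// lee_fin sqr_ge0.
Qed.

Lemma sqint_mul_integrable f g : sqint f -> sqint g ->
  mu.-integrable D (fun x => (f x * g x)%:E).
Proof.
move=> sf sg; have If := sqint_sqr_integrable f sf; have Ig := sqint_sqr_integrable g sg.
apply: (le_integrable mD _ _ (integrableD mD If Ig)).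
  by apply/measurable_EFinP; apply: measurable_funM; [exact: sf.1|exact: sg.1].
move=> x _ /=; rewrite lee_fin [leRHS]ger0_norm ?addr_ge0 ?sqr_ge0//.
rewrite ler_norml; have := sqr_ge0 (f x + g x); have := sqr_ge0 (f x - g x).
have := sqr_ge0 (f x); have := sqr_ge0 (g x).
by rewrite !expr2 => *; apply/andP; split; lra.
Qed.

Lemma linsub_sqint : linsub sqint.
Proof.
split.
  split; first exact: measurable_cst.
  by rewrite integral0_eq// => x _; rewrite expr0n.
move=> k f g sf sg; split.
  by apply: measurable_funD; [apply: measurable_funM => //; exact: sf.1|exact: sg.1].
have If := integrableZl mD (2 * k ^+ 2) (sqint_sqr_integrable f sf).
have Ig := integrableZl mD 2 (sqint_sqr_integrable g sg).
have := integrable_lty mD (integrableD mD If Ig).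
apply: le_lt_trans; apply: ge0_le_integral => //.
- by move=> x _; rewrite lee_fin sqr_ge0.
- apply/measurable_EFinP; apply: measurable_funX; apply: measurable_funD; last exact: sg.1.
  by apply: measurable_funM => //; exact: sf.1.
- by apply: (measurable_int mu); exact: integrableD.
- move=> x _ /=; rewrite -!EFinM -EFinD lee_fin.
  have -> : (k *: f + g) x = k * f x + g x by [].
  by have := sqr_ge0 (k * f x - g x); rewrite !expr2; lra.
Qed.

Lemma ip_sqrE f : sqint f -> (\int[mu]_(x in D) ((f x) ^+ 2)%:E = (ip f f)%:E)%E.
Proof.
move=> sf; rewrite /ip /Rintegral fineK//.
by apply: integrable_fin_num => //; exact: sqint_mul_integrable.
Qed.

Lemma psd_ip : psd sqint ip.
Proof.
split.
- by move=> f g _ _; apply: eq_Rintegral => x _; rewrite mulrC.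
- move=> k f g u sf sg su; rewrite /ip -RintegralZl//; last exact: sqint_mul_integrable.
  rewrite -RintegralD//; first by apply: eq_Rintegral => x _; rewrite mulrDl mulrA.
  + have := integrableZl mD k (sqint_mul_integrable f u sf su).
    by apply: eq_integrable => // x _; rewrite -EFinM.
  + exact: sqint_mul_integrable.
- by move=> f sf; apply: Rintegral_ge0 => x _; rewrite -expr2 sqr_ge0.
Qed.

Lemma ip_eq0 f : sqint f -> ip f f = 0 -> {ae mu, forall x, D x -> f x = 0}.
Proof.
move=> sf f0; have [mf _] := sf.
have m2 : measurable_fun D (fun x => (f x ^+ 2)%:E).
  by apply/measurable_EFinP; exact: measurable_funX.
have /(ae_eq_integral_abs mu mD m2) H : (\int[mu]_(x in D) `|(f x ^+ 2)%:E| = 0)%E.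
  rewrite (eq_integral (fun x => (f x ^+ 2)%:E)) ?ip_sqrE ?f0// => x _.
  by rewrite gee0_abs// lee_fin sqr_ge0.
by apply: filterS H => x H Dx; have /eqP := H Dx; rewrite eqe sqrf_eq0 => /eqP.
Qed.

Lemma ip_ae0 (f g : T -> R) : {ae mu, forall x, D x -> f x = 0} -> measurable_fun D f ->
  measurable_fun D g -> ip f g = 0.
Proof.
move=> f0 mf mg; rewrite /ip /Rintegral (ae_eq_integral (cst 0%E))//.
- by rewrite integral0.
- by apply/measurable_EFinP; exact: measurable_funM.
- by apply: filterS f0 => x f0 Dx /=; rewrite f0// mul0r.
Qed.

Lemma sqint_bounded (f : T -> R) (C : R) : (mu D < +oo)%E -> measurable_fun D f ->
  (forall x, D x -> `|f x| <= C) -> sqint f.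
Proof.
move=> Doo mf fC; split => //.
apply: (@le_lt_trans _ _ (\int[mu]_(x in D) (C ^+ 2)%:E)%E); last first.
  by rewrite integral_cst// lte_mul_pinfty// lee_fin sqr_ge0.
apply: ge0_le_integral => //.
- by move=> x _; rewrite lee_fin sqr_ge0.
- by apply/measurable_EFinP; exact: measurable_funX.
- move=> x Dx; rewrite lee_fin -real_normK ?num_real// lerXn2r ?nnegrE ?fC//.
  by rewrite (le_trans _ (fC x Dx)).
Qed.

Lemma limn_einf_le (u : (\bar R)^nat) (c : \bar R) n0 :
  (forall n, (n0 <= n)%N -> (u n <= c)%E) -> (limn_einf u <= c)%E.
Proof.
move=> uc; rewrite limn_einf_lim; apply: lime_le; first exact: is_cvg_einfs.
exists n0 => // n /= n0n; apply: le_trans (uc n n0n).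
by apply: ereal_inf_lbound; exists n => /=.
Qed.

Lemma sum_half (N : nat) : \sum_(0 <= i < N) (2^-1 : R) ^+ i = 2 - 2 * 2^-1 ^+ N.
Proof.
elim: N => [|N IH]; first by rewrite big_geq// expr0; ring.
by rewrite big_nat_recr//= IH exprS; field.
Qed.

(** Riesz-Fischer: consecutive differences are summable in L^1, so the telescoping series converges
    almost everywhere, and Fatou's lemma carries the Cauchy bound to the limit. *)
Lemma sqint_fast_cauchy (t : nat -> T -> R) : (mu D < +oo)%E -> (forall n, sqint (t n)) ->
  (forall n i j, (n <= i)%N -> (n <= j)%N -> ip (t i - t j) (t i - t j) <= (4^-1) ^+ n) ->
  exists2 f, sqint f & forall n, ip (t n - f) (t n - f) <= 4^-1 ^+ n.
Proof.
move=> Doo st ct.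
have stB i j : sqint (t i - t j) by apply: linsubB => //; exact: linsub_sqint.
pose u (x : T) n := t n.+1 x - t n x.
have mu_ n : measurable_fun D (u^~ n) by apply: measurable_funB; [exact: (st _).1|exact: (st _).1].
have mnu n : measurable_fun D (fun x => `|u x n|%:E).
  by apply/measurable_EFinP; exact: measurableT_comp.
pose c := 1 + fine (mu D).
have c0 : 0 <= c by rewrite addr_ge0// fine_ge0.
have intu n : (\int[mu]_(x in D) `|u x n|%:E <= (c * 2^-1 ^+ n)%:E)%E.
  have s1 : mu.-integrable D (fun x => (2 ^+ n * (u x n) ^+ 2)%:E).
    have := integrableZl mD (2 ^+ n) (sqint_sqr_integrable _ (stB n.+1 n)).
    by apply: eq_integrable => // x _; rewrite -EFinM.
  have s2 : mu.-integrable D (fun x => (2^-1 ^+ n)%:E).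
    apply/integrableP; split; first exact: measurable_cst.
    by rewrite integral_cst// lte_mul_pinfty// lee_fin.
  (* Pointwise |u| <= 2^n u^2 + 2^-n. The integral of u^2 is at most 4^-n and the measure is finite,
     so both terms integrate to a multiple of 2^-n. *)
  apply: (@le_trans _ _ (\int[mu]_(x in D) ((2 ^+ n * (u x n) ^+ 2)%:E + (2^-1 ^+ n)%:E))%E).
    apply: ge0_le_integral => //; first by apply: (measurable_int mu); exact: integrableD.
    move=> x Dx; rewrite -EFinD lee_fin -(real_normK (num_real (u x n))).
    move: (`|u x n|) (normr_ge0 (u x n)) => r r0.
    rewrite exprVn; have k0 : 0 < 2 ^+ n :> R by rewrite exprn_gt0.
    move: (2 ^+ n) k0 => k k0.
    have := sqr_ge0 (k * r - 1); rewrite !expr2 => H.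
    rewrite -(ler_pM2l k0) mulrDr divff ?gt_eqF//; nra.
  rewrite integralD// integral_cst//.
  under eq_integral do rewrite EFinM.
  rewrite integralZl//; last exact: (sqint_sqr_integrable _ (stB n.+1 n)).
  rewrite (ip_sqrE _ (stB n.+1 n)) -(@fineK _ (mu D)) ?ge0_fin_numE// -!EFinM -EFinD lee_fin.
  have := ct n n.+1 n (leqnSn n) (leqnn n).
  rewrite -[c]/(1 + fine (mu D)) mulrDl mul1r [fine _ * _]mulrC lerD2r => H.
  have -> : 2^-1 ^+ n = 2 ^+ n * 4^-1 ^+ n :> R by rewrite -exprMn; congr (_ ^+ _); field.
  by rewrite ler_wpM2l// exprn_ge0.
have sumoo : (\int[mu]_(x in D) (\big[+%E/0%R]_(0 <= n <oo) (`|u x n|)%:E) < +oo)%E.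
  rewrite integral_nneseries//; apply: (@le_lt_trans _ _ (2 * c)%:E); last exact: ltry.
  apply: lime_le; first by apply: is_cvg_nneseries => n _ _; exact: integral_ge0.
  apply: nearW => N; apply: (@le_trans _ _ (\sum_(0 <= n < N) (c * 2^-1 ^+ n)%:E)%E).
    by apply: lee_sum => n _; exact: intu.
  rewrite sumEFin lee_fin -mulr_sumr sum_half mulrC ler_wpM2r//.
  have : 0 <= 2^-1 ^+ N :> R by rewrite exprn_ge0.
  by lra.
pose S x := (\big[+%E/0%R]_(0 <= n <oo) (`|u x n|)%:E)%E.
have mS : measurable_fun D S by apply: ge0_emeasurable_sum.
have S0 x : (0 <= S x)%E by apply: nneseries_ge0.
have [N [mN N0 NS]] : mu.-negligible (~` [set x | D x -> S x \is a fin_num]).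
  apply: (integrable_ae mD); apply/integrableP; split => //.
  by under eq_integral do rewrite gee0_abs//.
pose G := D `\` N.
have mG : measurable G by exact: measurableD.
have GD : G `<=` D by move=> x [].
have cvgG x : G x -> cvgn (fun n => t n x).
  move=> [Dx Nx]; have Sf : S x \is a fin_num.
    by apply: contrapT => H; apply: Nx; apply: NS => /(_ Dx).
  have cs : cvgn [normed series (u x)].
    apply: nondecreasing_is_cvgn.
      apply: (nondecreasing_series (P := xpredT)) => n *; exact: normr_ge0.
    exists (fine (S x)) => _ [n _ <-].
    rewrite -lee_fin fineK// /series/= -sumEFin.
    by apply: nneseries_lim_ge.
  have : series (u x) = [sequence t n x - t 0%N x]_n.
    exact: (telescopeK (fun n => t n x)).
  move: (normed_cvg cs) => /[swap] -> /cvg_ex[l Hl].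
  apply/cvg_ex; exists (l + t 0%N x).
  have -> : (fun n => t n x) = (fun n => (t n x - t 0%N x) + t 0%N x).
    by apply/funext => n; rewrite subrK.
  by apply: cvgD => //; exact: cvg_cst.
(* The cut-off outside G makes the limit exist at every point, whence a measurable f. *)
pose g n x := \1_G x * t n x.
have mg n : measurable_fun D (g n).
  by apply: measurable_funM; [exact: measurable_indic|exact: (st n).1].
pose f x := limn (fun n => g n x).
have gf x : g n x @[n --> \oo] --> f x.
  rewrite /f /g; have [Gx|Gx] := pselect (G x).
    by rewrite indicE mem_set//; under eq_fun do rewrite mul1r; exact: cvgG.
  rewrite indicE memNset//; under eq_fun do rewrite mul0r.
  exact: is_cvg_cst.
have mf : measurable_fun D f by apply: (measurable_fun_cvg mg).
have key n : (\int[mu]_(x in D) ((t n x - f x) ^+ 2)%:E <= (4^-1 ^+ n)%:E)%E.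
  have mt i : measurable_fun D (fun x => ((t n x - t i x) ^+ 2)%:E).
    by apply/measurable_EFinP; apply: measurable_funX; exact: (stB n i).1.
  rewrite (ge0_negligible_integral mN)//; last first.
  - by move=> x _; rewrite lee_fin sqr_ge0.
  - apply/measurable_EFinP; apply: measurable_funX.
    by apply: measurable_funB => //; exact: (st n).1.
  rewrite -/G.
  have -> : (\int[mu]_(x in G) ((t n x - f x) ^+ 2)%:E =
     \int[mu]_(x in G) limn_einf (fun i => ((t n x - t i x) ^+ 2)%:E))%E.
    apply: eq_integral => x; rewrite inE => Gx.
    have H : ((t n x - t i x) ^+ 2)%:E @[i --> \oo] --> ((t n x - f x) ^+ 2)%:E.
      apply: cvg_EFin; first exact: nearW.
      have tf : t i x @[i --> \oo] --> f x.
        by have := gf x; rewrite /g; under eq_fun do rewrite indicE mem_set// mul1r.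
      have tf' : t n x - t i x @[i --> \oo] --> t n x - f x.
        by apply: cvgB => //; exact: cvg_cst.
      by apply: cvgM.
    by rewrite (cvg_limn_einf_sup H).1.
  apply: (le_trans (fatou mu mG _ _)).
  - by move=> i; apply: measurable_funS (mt i).
  - by move=> i x _; rewrite lee_fin sqr_ge0.
  apply: (@limn_einf_le _ _ n) => i ni.
  apply: (@le_trans _ _ (\int[mu]_(x in D) ((t n x - t i x) ^+ 2)%:E)%E).
    apply: ge0_subset_integral => //.
    by move=> x _; rewrite lee_fin sqr_ge0.
  by rewrite (ip_sqrE _ (stB n i)) lee_fin ct.
have stf n : sqint (t n - f).
  split; first by apply: measurable_funB => //; exact: (st n).1.
  by apply: le_lt_trans (key n) _; exact: ltry.
exists f => [|n]; last by rewrite -lee_fin -(ip_sqrE _ (stf n)); exact: key.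
rewrite -[f](subKr (t 0%N)).
by apply: linsubB => //; exact: linsub_sqint.
Qed.

Lemma sqint_complete : (mu D < +oo)%E -> seq_complete sqint ip.
Proof.
move=> Doo s ss cs.
have /choice[k kP] : forall n : nat, exists k, forall i j, (k <= i)%N -> (k <= j)%N ->
    ip (s i - s j) (s i - s j) <= 4^-1 ^+ n.
  by move=> n; apply: cs; rewrite exprn_gt0// invr_gt0.
(* Running maximum of the thresholds: K i lies beyond k n for every n <= i. *)
pose K := fix K n := if n is n'.+1 then maxn (K n') (k n) else k 0%N.
have Kk n i : (n <= i)%N -> (k n <= K i)%N.
  elim: i => [|i IH]; first by rewrite leqn0 => /eqP ->.
  rewrite leq_eqVlt => /predU1P[->|]; first by rewrite /= leq_maxr.
  by rewrite ltnS => /IH H; rewrite /= (leq_trans H)// leq_maxl.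
have [|n i j ni nj|f sf Hf] := sqint_fast_cauchy (fun n => s (K n)) Doo.
- by move=> n; exact: ss.
- by apply: kP; exact: Kk.
exists f => //; apply/cvgrPdist_le => e e0.
have c4 : (4^-1 : R) ^+ n @[n --> \oo] --> 0.
  by apply: cvg_expr; rewrite ger0_norm; lra.
have e4 : 0 < e / 4 by rewrite divr_gt0.
have /cvgrPdist_le/(_ _ e4)[n0 _ Hn0] := c4.
have H4 : 4^-1 ^+ n0 <= e / 4.
  by have /= := Hn0 n0 (leqnn _); rewrite sub0r normrN ger0_norm// exprn_ge0// invr_ge0.
exists (k n0) => // i /= ki; rewrite sub0r normrN.
have sB := linsubB _ _ _ linsub_sqint (ss i) sf.
rewrite ger0_norm ?(psd_ge0 psd_ip)//.
apply: (le_trans (psd_quadB_le2 linsub_sqint psd_ip _ _ (s (K n0)) (ss i) sf (ss _))).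
have := Hf n0; have := kP n0 i (K n0) ki (Kk n0 n0 (leqnn _)).
by lra.
Qed.
End SquareIntegrable.

(** * Test functions on the square *)

Section Plane.
Context {R : realType}.
Notation T2 := (measurableTypeR R * measurableTypeR R)%type.

Definition nu : measure T2 R := (@lebesgue_measure R \x @lebesgue_measure R)%E.

(** The product sigma-algebra comes from rectangles, so an open set is written as the countable
    union of the boxes with rational corners that it contains. *)
Lemma continuous_measurable2 (f : R * R -> R) :
  continuous f -> measurable_fun [set: T2] f.
Proof.
move=> /continuousP cf; apply: (measurability _ (RGenOpens.measurableE R)).
move=> _ [_ [a [b ->] <-]]; rewrite setTI.
set O := f @^-1` _; have oO : open O by exact/cf/interval_open.
pose box (q : (rat * rat) * (rat * rat)) : set T2 :=
  `]ratr q.1.1, ratr q.1.2[%classic `*` `]ratr q.2.1, ratr q.2.2[%classic.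
have -> : O = \bigcup_q (if pselect (box q `<=` O) then box q else set0).
  apply/seteqP; split => [x Ox|x [q _]]; last by case: pselect => // H; exact: H.
  have /nbhs_ballP[e /= e0 xe] : nbhs x O by exact: open_nbhs_nbhs.
  have [q1 /[!in_itv]/= /andP[q1l q1r]] := @rat_in_itvoo R (x.1 - e) x.1 ltac:(lra).
  have [q2 /[!in_itv]/= /andP[q2l q2r]] := @rat_in_itvoo R x.1 (x.1 + e) ltac:(lra).
  have [q3 /[!in_itv]/= /andP[q3l q3r]] := @rat_in_itvoo R (x.2 - e) x.2 ltac:(lra).
  have [q4 /[!in_itv]/= /andP[q4l q4r]] := @rat_in_itvoo R x.2 (x.2 + e) ltac:(lra).
  exists ((q1, q2), (q3, q4)) => //; case: pselect => [sub|[]] /=.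
    by split; rewrite /= in_itv /=; apply/andP.
  move=> y []; rewrite /= !in_itv /= => /andP[y1 y2] /andP[y3 y4].
  apply: xe; split; rewrite /ball /= ltr_norml; lra.
apply: countable_bigcupT_measurable; first exact: countableP.
move=> q; case: pselect => [sub|nsub] /=; last exact: measurable0.
by apply: measurableX; exact: measurable_itv.
Qed.

Lemma OmE : @Om R = `]0, 1[%classic `*` `]0, 1[%classic.
Proof. by apply/seteqP; split => x; rewrite /Om /= !in_itv /=. Qed.

Lemma measurable_Om : measurable (Om : set T2).
Proof. by rewrite OmE; apply: measurableX; exact: measurable_itv. Qed.

Lemma nuX (A B : set (measurableTypeR R)) : measurable A -> measurable B ->
  nu (A `*` B) = (lebesgue_measure A * lebesgue_measure B)%E.
Proof. exact: product_measure1E. Qed.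

Lemma nu_Om : (nu Om < +oo)%E.
Proof.
rewrite OmE nuX; [|exact: measurable_itv..].
by rewrite !lebesgue_measure_itv /= lte01 oppr0 adde0 mule1 ltry.
Qed.

Lemma continuous_bounded_Om (f : R * R -> R) : continuous f ->
  exists C, forall x, Om x -> `|f x| <= C.
Proof.
move=> cf.
have cK : compact (`[0:R, 1]%classic `*` `[0:R, 1]%classic).
  by apply: compact_setX; exact: segment_compact.
have /compact_bounded [C [_ HC]] := continuous_compact (continuous_subspaceT cf) cK.
exists (C + 1) => x [/andP[x1 x2] /andP[x3 x4]].
apply: (HC (C + 1)); first by rewrite ltrDl.
by exists x => //; split; rewrite /= in_itv /= !ltW.
Qed.

Notation sqintO := (sqint (mu := nu) (D := Om)).
Notation ipO := (ip (mu := nu) (D := Om)).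

Lemma sqint_continuous (f : R * R -> R) : continuous f -> sqintO f.
Proof.
move=> cf; have [C HC] := continuous_bounded_Om f cf.
apply: (sqint_bounded measurable_Om f C nu_Om) => //.
by apply: measurable_funTS; exact: continuous_measurable2.
Qed.

Lemma iterD_lin l (k : R) (f g : R * R -> R) : smooth f -> smooth g ->
  Defs.iterD l (k *: f + g) = k *: Defs.iterD l f + Defs.iterD l g.
Proof.
move=> sf sg; elim: l => [//|v l IH] /=; rewrite IH; apply/funext => x.
have [_ df] := sf l; have [_ dg] := sg l.
rewrite deriveD//; first by rewrite deriveZ.
exact: derivableZ.
Qed.

Lemma test_fun_lin (k : R) (f g : R * R -> R) :
  test_fun f -> test_fun g -> test_fun (k *: f + g).
Proof.
move=> [sf [K [cK KO f0]]] [sg [L [cL LO g0]]]; split.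
  move=> l; rewrite iterD_lin//.
  have [cf df] := sf l; have [cg dg] := sg l; split.
    move=> x; apply: cvgD; last exact: cg.
    by apply: cvgZ; [exact: cvg_cst|exact: cf].
  by move=> v x; apply: derivableD => //; exact: derivableZ.
exists (K `|` L); split; first exact: compactU.
  by move=> x [/KO|/LO].
move=> x /not_orP[nK nL].
have -> : (k *: f + g) x = k * f x + g x by [].
by rewrite f0// g0// mulr0 addr0.
Qed.

Lemma test_fun_continuous (f : R * R -> R) : test_fun f -> continuous f.
Proof. by move=> [/(_ [::])[]]. Qed.

Lemma test_fun_derive_continuous (f : R * R -> R) (v : R * R) : test_fun f -> continuous ('D_v f).
Proof. by move=> [/(_ [:: v])[]]. Qed.

Lemma test_fun0 : test_fun (0 : R * R -> R).
Proof.
have D0 l : Defs.iterD l (0 : R * R -> R) = 0.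
  by elim: l => [//|v l /= ->]; apply/funext => x; rewrite derive_cst.
split; last by exists set0; split => //; exact: compact0.
move=> l; rewrite D0; split => [x|v x]; [exact: cvg_cst|exact: derivable_cst].
Qed.
End Plane.

(** * The degenerate Sobolev space *)

Lemma psd_pullback (R : realType) (E F : lmodType R) (X : E -> Prop) (Y : F -> Prop)
    (f : F -> F -> R) (l : E -> F) :
  (forall k x y, l (k *: x + y) = k *: l x + l y) -> (forall x, X x -> Y (l x)) ->
  psd Y f -> psd X (fun x y => f (l x) (l y)).
Proof.
move=> ll XY [f1 f2 f3]; split.
- by move=> x y /XY Yx /XY Yy; exact: f1.
- by move=> k x y z /XY Yx /XY Yy /XY Yz; rewrite ll f2.
- by move=> x /XY Yx; exact: f3.
Qed.

Section DegenerateSpace.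
Context {R : realType}.
Variable h : R -> R.
Notation T2 := (measurableTypeR R * measurableTypeR R)%type.
Notation F := (R * R -> R).
Notation E := (F * F * F)%type.
Notation sqintO := (sqint (mu := nu) (D := Om)).
Notation ipO := (ip (mu := nu) (D := Om)).
Hypothesis h_gt0 : forall x, 0 < x < 1 -> 0 < h x.
Hypothesis h_bdd : exists B, forall x, 0 < x < 1 -> h x <= B.
Hypothesis h_meas : measurable_fun (Om : set T2) (fun z => h z.1).
Hypothesis h_int : (\int[nu]_(z in Om) ((h z.1)^-1)%:E < +oo)%E.

Let mOm : measurable (Om : set T2) := measurable_Om.

Definition wt (g : F) : F := fun z => Num.sqrt (h z.1) * g z.

(* Points of the Hilbert space are triples (u, g1, g2), u together with its
   weak derivatives. That u determines g1 and g2 is never needed: an eigenvector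
   with u = 0 has zero energy. *)
Definition triple (x : E) :=
  [/\ sqintO x.1.1, sqintO x.1.2, measurable_fun (Om : set T2) x.2 & sqintO (wt x.2)].

Definition mass (x y : E) := ipO x.1.1 y.1.1.
Definition energy (x y : E) := ipO x.1.2 y.1.2 + ipO (wt x.2) (wt y.2).
Definition grad (f : F) : E := (f, 'D_e1 f, 'D_e2 f).
Notation normf := (form_add energy mass).

(** The points of [Hh10], with the extended-real integrals of its closure clause replaced by the
    real form; [spaceP] is the translation. *)
Definition space (x : E) := [/\ triple x, weak_deriv e1 x.1.1 x.1.2, weak_deriv e2 x.1.1 x.2
  & exists phi : nat -> F, (forall n, test_fun (phi n)) /\
      normf (grad (phi n) - x) (grad (phi n) - x) @[n --> \oo] --> 0].

Lemma wt_lin k f g : wt (k *: f + g) = k *: wt f + wt g.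
Proof.
apply/funext => z; rewrite /wt.
change (Num.sqrt (h z.1) * (k * f z + g z) =
  k * (Num.sqrt (h z.1) * f z) + Num.sqrt (h z.1) * g z).
by ring.
Qed.

Let lin1 k (x y : E) : (k *: x + y).1.1 = k *: x.1.1 + y.1.1.
Proof. by []. Qed.
Let lin2 k (x y : E) : (k *: x + y).1.2 = k *: x.1.2 + y.1.2.
Proof. by []. Qed.
Let lin3 k (x y : E) : (k *: x + y).2 = k *: x.2 + y.2.
Proof. by []. Qed.
Let lin4 k (x y : E) : wt (k *: x + y).2 = k *: wt x.2 + wt y.2.
Proof. by rewrite lin3 wt_lin. Qed.

Lemma linsub_triple : linsub triple.
Proof.
have L := @linsub_sqint _ _ _ (@nu R) _ mOm; split.
  split; [exact: L.1|exact: L.1|exact: measurable_cst|].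
  have -> : wt (0 : E).2 = 0 by apply/funext => z; rewrite /wt mulr0.
  exact: L.1.
move=> k x y [x1 x2 x3 x4] [y1 y2 y3 y4]; split.
- by rewrite lin1; exact: L.2.
- by rewrite lin2; exact: L.2.
- rewrite lin3.
  have mk : measurable_fun (Om : set T2) (fun z => k * x.2 z + y.2 z).
    by apply: measurable_funD => //; exact: measurable_funM.
  exact mk.
- by rewrite lin4; exact: L.2.
Qed.

Let sT := linsub_triple.

Lemma psd_mass : psd triple mass.
Proof.
apply: (@psd_pullback R E F triple sqintO ipO (fun x => x.1.1) lin1).
  by move=> x [].
exact: (psd_ip mOm).
Qed.

Lemma psd_energy : psd triple energy.
Proof.
have H1 : psd triple (fun x y => ipO x.1.2 y.1.2).
  apply: (@psd_pullback R E F triple sqintO ipO (fun x => x.1.2) lin2).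
    by move=> x [].
  exact: (psd_ip mOm).
have H2 : psd triple (fun x y => ipO (wt x.2) (wt y.2)).
  apply: (@psd_pullback R E F triple sqintO ipO (fun x => wt x.2) lin4).
    by move=> x [].
  exact: (psd_ip mOm).
exact: (psd_add _ _ _ H1 H2).
Qed.

Let psd_normf : psd triple normf.
Proof. by apply: psd_add; [exact: psd_energy|exact: psd_mass]. Qed.

Lemma hOm z : Om z -> 0 < h z.1.
Proof. by move=> [z1 _]; exact: h_gt0. Qed.

Lemma wt_meas : measurable_fun (Om : set T2) (fun z => Num.sqrt (h z.1)).
Proof.
apply: (measurable_comp (F := setT)) => //.
by apply: continuous_measurable_fun; exact: sqrt_continuous.
Qed.

Lemma triple_grad f : test_fun f -> triple (grad f).
Proof.
move=> tf; have [s0 s1 s2] : [/\ sqintO f, sqintO ('D_e1 f) & sqintO ('D_e2 f)].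
  by split; apply: sqint_continuous;
    [exact: test_fun_continuous|exact: test_fun_derive_continuous..].
split; [exact: s0|exact: s1|exact: s2.1|].
split; first by apply: measurable_funM; [exact: wt_meas|exact: s2.1].
have [B HB] := h_bdd.
have B0 : 0 < B.
  have H : (0 < (2^-1 : R) < 1)%R by rewrite invr_gt0 ltr0n invf_lt1 ?ltr1n ?ltr0n.
  by apply: lt_le_trans (HB _ H); exact: h_gt0.
apply: (@le_lt_trans _ _ (\int[nu]_(x in Om) (B%:E * ('D_e2 f x ^+ 2)%:E))%E).
  apply: ge0_le_integral => //.
  - by move=> x _; rewrite lee_fin sqr_ge0.
  - apply/measurable_EFinP; apply: measurable_funX.
    by apply: measurable_funM; [exact: wt_meas|exact: s2.1].
  - apply/measurable_EFinP; apply: measurable_funM => //.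
    by apply: measurable_funX; exact: s2.1.
  - move=> x Ox; rewrite -EFinM lee_fin /wt exprMn sqr_sqrtr ?(ltW (hOm x Ox))//.
    by rewrite ler_wpM2r ?sqr_ge0//; apply: HB; exact: Ox.1.
by rewrite integralZl//; [rewrite (ip_sqrE mOm _ s2) -EFinM ltry|exact: sqint_sqr_integrable].
Qed.

Lemma normfE x : triple x ->
  (\int[mu2]_(z in Om) ((x.1.1 z) ^+ 2 + (x.1.2 z) ^+ 2 + h z.1 * (x.2 z) ^+ 2)%:E
   = (normf x x)%:E)%E.
Proof.
move=> [s1 s2 s3 s4].
transitivity (\int[nu]_(z in Om) (((x.1.1 z ^+ 2)%:E + (x.1.2 z ^+ 2)%:E)
    + (wt x.2 z ^+ 2)%:E))%E.
  apply: eq_integral => z; rewrite inE => Oz; rewrite -!EFinD; congr (_ + _)%:E.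
  by rewrite /wt exprMn sqr_sqrtr// ltW// hOm.
have i1 := sqint_sqr_integrable _ s1.
have i2 := sqint_sqr_integrable _ s2.
have i4 := sqint_sqr_integrable _ s4.
rewrite integralD//; last exact: integrableD.
rewrite integralD// (ip_sqrE mOm _ s1) (ip_sqrE mOm _ s2) (ip_sqrE mOm _ s4).
by rewrite -!EFinD /form_add /mass /energy; congr (_%:E); ring.
Qed.

Lemma spaceP u g1 g2 : Hh10 h u g1 g2 <-> space (u, g1, g2).
Proof.
have H : Hh1 h u g1 g2 <-> [/\ triple (u, g1, g2), weak_deriv e1 u g1 & weak_deriv e2 u g2].
  by split => [[[? ? ?] [? ? ?]]|[[? ? ? ?] ? ?]]; split => //; split.
have eqE (phi : nat -> F) : triple (u, g1, g2) -> (forall n, test_fun (phi n)) ->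
  (fun n => \int[mu2]_(x in Om)
        (((phi n x - u x) ^+ 2 + ('D_e1 (phi n) x - g1 x) ^+ 2
          + h x.1 * ('D_e2 (phi n) x - g2 x) ^+ 2)%:E))%E =
  (fun n => (normf (grad (phi n) - (u, g1, g2)) (grad (phi n) - (u, g1, g2)))%:E).
  move=> tu tphi; apply/funext => n; rewrite -normfE//.
  by apply: linsubB => //; exact: triple_grad.
split.
  move=> [/H[tu w1 w2] [phi [tphi cphi]]]; split => //; exists phi; split => //.
  by move: cphi; rewrite (eqE phi tu tphi) => /fine_cvgP[].
move=> [tu w1 w2 [phi [tphi cphi]]]; split; first exact/H.
exists phi; split => //; rewrite (eqE phi tu tphi).
by apply: cvg_EFin => //; exact: nearW.
Qed.

(** Integrability of g phi is part of [weak_deriv] and is what allows the right-hand integral to be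
    split; it is not automatic, g being possibly outside L^2. *)
Lemma weak_deriv_lin v k (u u' g g' : F) : sqintO u -> sqintO u' ->
  weak_deriv v u g -> weak_deriv v u' g' -> weak_deriv v (k *: u + u') (k *: g + g').
Proof.
move=> su su' w w' phi tphi; have [i e] := w phi tphi; have [i' e'] := w' phi tphi.
have sD : sqintO ('D_v phi) by apply: sqint_continuous; exact: test_fun_derive_continuous.
have ik : nu.-integrable Om (fun x => (k * (g x * phi x))%:E).
  by have := integrableZl mOm k i; apply: eq_integrable => // x _; rewrite -EFinM.
have eqg (x : R * R) : (k *: g + g') x * phi x = k * (g x * phi x) + g' x * phi x.
  by change ((k * g x + g' x) * phi x = k * (g x * phi x) + g' x * phi x); ring.
split.
  have := integrableD mOm ik i'; apply: eq_integrable => // x _.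
  by rewrite eqg EFinD.
have := psdl (psd_ip mOm) k u u' _ su su' sD.
rewrite /ipO => ->; rewrite e e'.
have -> : (fun x => (k *: g + g') x * phi x) = (fun x => k * (g x * phi x) + g' x * phi x).
  by apply/funext => x; exact: eqg.
by rewrite RintegralD// RintegralZl//; ring.
Qed.

Lemma grad_lin k f g : test_fun f -> test_fun g ->
  grad (k *: f + g) = k *: grad f + grad g.
Proof.
move=> [sf _] [sg _]; rewrite /grad.
by have /= -> := iterD_lin [:: e1] k f g sf sg; have /= -> := iterD_lin [:: e2] k f g sf sg.
Qed.

Lemma linsub_space : linsub space.
Proof.
split.
  have w0 v : weak_deriv v (0 : F) (0 : F).
    move=> phi tphi; split.
      under eq_fun do rewrite mul0r.
      exact: integrable0.
    by rewrite /Rintegral !integral0_eq ?oppr0// => x _; rewrite mul0r.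
  split => //; first exact: sT.1.
  exists (fun=> 0); split => [n|]; first exact: test_fun0.
  have -> : grad (0 : F) = 0.
    by rewrite /grad; congr (_, _, _); apply/funext => z; rewrite derive_cst.
  rewrite subr0 (psd0l sT psd_normf) //; [exact: cvg_cst|exact: sT.1].
move=> k x y [tx wx1 wx2 [phi [tphi cphi]]] [ty wy1 wy2 [psi [tpsi cpsi]]]; split.
- exact: sT.2.
- by rewrite lin1 lin2; apply: weak_deriv_lin wx1 wy1; [case: tx|case: ty].
- by rewrite lin1 lin3; apply: weak_deriv_lin wx2 wy2; [case: tx|case: ty].
- exists (fun n => k *: phi n + psi n); split; first by move=> n; exact: test_fun_lin.
  pose A n := normf (grad (phi n) - x) (grad (phi n) - x).
  pose B n := normf (grad (psi n) - y) (grad (psi n) - y).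
  have cv : 2 * k ^+ 2 * A n + 2 * B n @[n --> \oo] --> 0.
    rewrite -[X in _ --> X](_ : 2 * k ^+ 2 * 0 + 2 * 0 = 0); last by ring.
    by apply: cvgD; apply: cvgM => //; exact: cvg_cst.
  apply: (squeeze_cvgr _ (cvg_cst 0) cv); apply: nearW => n /=.
  have t1 : triple (grad (phi n) - x) by apply: linsubB => //; exact: triple_grad.
  have t2 : triple (grad (psi n) - y) by apply: linsubB => //; exact: triple_grad.
  have -> : grad (k *: phi n + psi n) - (k *: x + y) =
     k *: (grad (phi n) - x) + (grad (psi n) - y).
    by rewrite grad_lin// scalerBr opprD addrACA.
  rewrite (psd_ge0 psd_normf)/=; last exact: sT.2.
  have := psd_quad_le2 sT psd_normf _ _ (linsubZ _ k _ sT t1) t2.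
  by rewrite (psd_quadZ sT psd_normf)// -/(A n) -/(B n); lra.
Qed.

(** g2 phi is the product of sqrt h g2 and phi / sqrt h, both in L^2 since phi is bounded and 1/h
    integrable. The same division recovers g2 from a limit of sqrt h g2. *)
Let inv_wt (phi : F) : F := fun z => (Num.sqrt (h z.1))^-1 * phi z.

Let sqrt_gt0 z : Om z -> 0 < Num.sqrt (h z.1).
Proof. by move=> Oz; rewrite sqrtr_gt0 hOm. Qed.

Let measurable_inv_wt : measurable_fun (Om : set T2) (fun z => (Num.sqrt (h z.1))^-1).
Proof.
have mV : measurable_fun (`]0, +oo[%classic : set R) (@GRing.inv R).
  apply: open_continuous_measurable_fun; first exact: interval_open.
  move=> x; rewrite inE /= in_itv /= andbT => x0.
  by apply: inv_continuous; rewrite gt_eqF.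
have sub : (fun z => Num.sqrt (h z.1)) @` (Om : set T2) `<=` (`]0, +oo[%classic : set R).
  by move=> _ [z Oz <-]; rewrite /= in_itv /= andbT sqrt_gt0.
have H := measurable_comp (measurable_itv `](0 : R), +oo[) sub mV wt_meas.
exact H.
Qed.

Let sqint_inv_wt phi : continuous phi -> sqintO (inv_wt phi).
Proof.
move=> cphi; have [C HC] := continuous_bounded_Om phi cphi.
have sphi := sqint_continuous phi cphi.
have mi : measurable_fun (Om : set T2) (inv_wt phi).
  by apply: measurable_funM => //; exact: sphi.1.
split => //.
have mhi : measurable_fun (Om : set T2) (fun z => ((h z.1)^-1)%:E).
  apply/measurable_EFinP; apply: (eq_measurable_fun (fun z => (Num.sqrt (h z.1))^-1 ^+ 2)).
    by move=> z; rewrite inE => Oz; rewrite exprVn sqr_sqrtr// ltW// hOm.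
  exact: measurable_funX.
apply: (@le_lt_trans _ _ (\int[nu]_(x in Om) ((C ^+ 2)%:E * ((h x.1)^-1)%:E))%E).
  apply: ge0_le_integral => //.
  - by move=> x _; rewrite lee_fin sqr_ge0.
  - by apply/measurable_EFinP; exact: measurable_funX.
  - by apply: emeasurable_funM => //; exact: measurable_cst.
  - move=> x Ox; rewrite -EFinM lee_fin /inv_wt exprMn exprVn sqr_sqrtr ?(ltW (hOm x Ox))//.
    rewrite mulrC ler_wpM2r// ?invr_ge0 ?(ltW (hOm x Ox))//.
    rewrite -(real_normK (num_real (phi x))) lerXn2r ?nnegrE ?HC//.
    by rewrite (le_trans _ (HC x Ox)).
rewrite ge0_integralZl//; first by rewrite lte_mul_pinfty// lee_fin sqr_ge0.
- by move=> x Ox; rewrite lee_fin invr_ge0 ltW// hOm.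
- by rewrite lee_fin sqr_ge0.
Qed.

Let wt_pair g phi z : Om z -> g z * phi z = wt g z * inv_wt phi z.
Proof.
move=> Oz; rewrite /wt /inv_wt mulrCA !mulrA mulVf ?mul1r//.
by rewrite gt_eqF// sqrt_gt0.
Qed.

(** Completeness of L^2 three times; the third limit G is that of the weighted derivatives, and G /
    sqrt h is the third component of the limit. *)
Lemma triple_complete : seq_complete triple normf.
Proof.
move=> s ts cs.
have cmp := @sqint_complete _ _ _ (@nu R) _ mOm nu_Om.
have ge_m x : triple x -> ipO x.1.1 x.1.1 <= normf x x.
  by move=> tx; rewrite /form_add lerDr (psd_ge0 psd_energy).
have ge_e1 x : triple x -> ipO x.1.2 x.1.2 <= normf x x.
  move=> [x1 x2 x3 x4]; rewrite /form_add /energy /mass.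
  have := psd_ge0 (psd_ip mOm) _ x1; have := psd_ge0 (psd_ip mOm) _ x4; lra.
have ge_e2 x : triple x -> ipO (wt x.2) (wt x.2) <= normf x x.
  move=> [x1 x2 x3 x4]; rewrite /form_add /energy /mass.
  have := psd_ge0 (psd_ip mOm) _ x1; have := psd_ge0 (psd_ip mOm) _ x2; lra.
have wtB f g : wt (f - g) = wt f - wt g.
  by rewrite addrC -scaleN1r wt_lin scaleN1r addrC.
have tB i j : triple (s i - s j) by exact: linsubB.
have [n|e e0|u su cu] := cmp (fun n => (s n).1.1).
- by case: (ts n).
- have [n0 H] := cs e e0; exists n0 => i j ni nj.
  exact: (le_trans (ge_m _ (tB i j)) (H i j ni nj)).
have [n|e e0|g1 sg1 cg1] := cmp (fun n => (s n).1.2).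
- by case: (ts n).
- have [n0 H] := cs e e0; exists n0 => i j ni nj.
  exact: (le_trans (ge_e1 _ (tB i j)) (H i j ni nj)).
have [n|e e0|G sG cG] := cmp (fun n => wt (s n).2).
- by case: (ts n).
- have [n0 H] := cs e e0; exists n0 => i j ni nj.
  by rewrite -wtB; exact: (le_trans (ge_e2 _ (tB i j)) (H i j ni nj)).
have wG z : Om z -> wt (inv_wt G) z = G z.
  by move=> Oz; rewrite /wt /inv_wt mulrA divff ?mul1r// gt_eqF// sqrt_gt0.
have swG : sqintO (wt (inv_wt G)).
  have [mG iG] := sG; split.
    by apply: (eq_measurable_fun G) => // z; rewrite inE => Oz; rewrite wG.
  rewrite (eq_integral (fun z => (G z ^+ 2)%:E))// => z; rewrite inE => Oz.
  by rewrite wG.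
exists (u, g1, inv_wt G).
  by split => //; apply: measurable_funM => //; exact: sG.1.
have H n : ipO (wt (s n).2 - wt (inv_wt G)) (wt (s n).2 - wt (inv_wt G)) =
    ipO (wt (s n).2 - G) (wt (s n).2 - G).
  apply: eq_Rintegral => z; rewrite inE => Oz.
  have -> : (wt (s n).2 - wt (inv_wt G)) z = wt (s n).2 z - wt (inv_wt G) z by [].
  by rewrite wG.
have -> : (fun n => normf (s n - (u, g1, inv_wt G)) (s n - (u, g1, inv_wt G))) =
   (fun n => (ipO ((s n).1.2 - g1) ((s n).1.2 - g1) +
      ipO (wt (s n).2 - G) (wt (s n).2 - G)) + ipO ((s n).1.1 - u) ((s n).1.1 - u)).
  by apply/funext => n; rewrite -H /form_add /energy /mass /= -wtB.
rewrite -[X in _ --> X](_ : 0 + 0 + 0 = 0); last by rewrite !addr0.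
by apply: cvgD => //; apply: cvgD.
Qed.

(** Both sides of the identity defining a weak derivative are L^2 pairings, hence continuous. The
    approximating test functions are chosen within 1 / (n + 1) of s n. *)
Lemma space_complete : seq_complete space normf.
Proof.
move=> s ss cs; have ts n : triple (s n) by case: (ss n).
have [x tx cx] := triple_complete s ts cs; exists x => //.
have tB n : triple (s n - x) by exact: linsubB.
have cvp (f : E -> E -> R) : psd triple f -> (forall y, triple y -> f y y <= normf y y) ->
    f (s n - x) (s n - x) @[n --> \oo] --> 0.
  move=> pf fn; apply: (squeeze_cvgr _ (cvg_cst 0) cx); apply: nearW => n /=.
  by rewrite (psd_ge0 pf)//= fn.
have lim_ip (l : E -> F) phi : (forall k x y, l (k *: x + y) = k *: l x + l y) ->
    (forall y, triple y -> sqintO (l y)) ->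
    (forall y, triple y -> ipO (l y) (l y) <= normf y y) -> sqintO phi ->
    ipO (l (s n)) phi @[n --> \oo] --> ipO (l x) phi.
  move=> ll sl nl sphi.
  apply: (psd_cvg0 (linsub_sqint mOm) (psd_ip mOm)) => //; [by move=> n; exact: sl|exact: sl|].
  have lB y z : l (y - z) = l y - l z by rewrite addrC -scaleN1r ll scaleN1r addrC.
  have pl : psd triple (fun x y => ipO (l x) (l y)).
    exact: (@psd_pullback R E F triple sqintO ipO l ll sl (psd_ip mOm)).
  have := cvp (fun x y => ipO (l x) (l y)) pl nl.
  by under eq_fun do rewrite lB.
have ge_m y : triple y -> ipO y.1.1 y.1.1 <= normf y y.
  by move=> ty; rewrite /form_add lerDr (psd_ge0 psd_energy).
have ge_e1 y : triple y -> ipO y.1.2 y.1.2 <= normf y y.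
  move=> [x1 x2 x3 x4]; rewrite /form_add /energy /mass.
  have := psd_ge0 (psd_ip mOm) _ x1; have := psd_ge0 (psd_ip mOm) _ x4; lra.
have ge_e2 y : triple y -> ipO (wt y.2) (wt y.2) <= normf y y.
  move=> [x1 x2 x3 x4]; rewrite /form_add /energy /mass.
  have := psd_ge0 (psd_ip mOm) _ x1; have := psd_ge0 (psd_ip mOm) _ x2; lra.
have cu phi : sqintO phi -> ipO (s n).1.1 phi @[n --> \oo] --> ipO x.1.1 phi.
  by apply: (lim_ip (fun x => x.1.1) phi lin1) => // y [].
have cg1 phi : sqintO phi -> ipO (s n).1.2 phi @[n --> \oo] --> ipO x.1.2 phi.
  by apply: (lim_ip (fun x => x.1.2) phi lin2) => // y [].
have cg2 phi : sqintO phi -> ipO (wt (s n).2) phi @[n --> \oo] --> ipO (wt x.2) phi.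
  by apply: (lim_ip (fun x => wt x.2) phi lin4) => // y [].
have [tx1 tx2 tx3 tx4] := tx.
split => //.
- move=> phi tphi; have cphi := test_fun_continuous phi tphi.
  have sphi := sqint_continuous phi cphi.
  have sD := sqint_continuous _ (test_fun_derive_continuous phi e1 tphi).
  split; first exact: sqint_mul_integrable.
  have c1 := cu _ sD; have c2 : - ipO (s n).1.2 phi @[n --> \oo] --> - ipO x.1.2 phi.
    by apply: cvgN; exact: cg1.
  have Ec : (fun n => ipO (s n).1.1 ('D_e1 phi)) = (fun n => - ipO (s n).1.2 phi).
    by apply/funext => n; have [_ w _ _] := ss n; exact: (w phi tphi).2.
  rewrite Ec in c1; have E1 := cvg_lim (@Rhausdorff R) c1.
  by have E2 := cvg_lim (@Rhausdorff R) c2; rewrite E1 in E2; exact: E2.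
- move=> phi tphi; have cphi := test_fun_continuous phi tphi.
  have sphi := sqint_inv_wt phi cphi.
  have sD := sqint_continuous _ (test_fun_derive_continuous phi e2 tphi).
  split.
    have := sqint_mul_integrable mOm _ _ tx4 sphi.
    by apply: eq_integrable => // z; rewrite inE => Oz; rewrite -wt_pair.
  have c1 := cu _ sD.
  have c2 : - ipO (wt (s n).2) (inv_wt phi) @[n --> \oo] --> - ipO (wt x.2) (inv_wt phi).
    by apply: cvgN; exact: cg2.
  have E (g : F) : ipO g phi = ipO (wt g) (inv_wt phi).
    by apply: eq_Rintegral => z; rewrite inE => Oz; rewrite -wt_pair.
  have Ec : (fun n => ipO (s n).1.1 ('D_e2 phi)) = (fun n => - ipO (wt (s n).2) (inv_wt phi)).
    by apply/funext => n; rewrite -E; have [_ _ w _] := ss n; exact: (w phi tphi).2.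
  rewrite Ec in c1; have E1 := cvg_lim (@Rhausdorff R) c1.
  by have E2 := cvg_lim (@Rhausdorff R) c2; rewrite E1 -E in E2; exact: E2.
have /choice[phi Hphi] : forall n : nat, exists phi, test_fun phi /\
    normf (grad phi - s n) (grad phi - s n) <= n.+1%:R^-1.
  move=> n; have [_ _ _ [psi [tpsi cpsi]]] := ss n.
  have n1 : 0 < n.+1%:R^-1 :> R by rewrite invr_gt0.
  have /cvgrPdist_le/(_ _ n1)[k _ Hk] := cpsi.
  exists (psi k); split => //; have /= := Hk k (leqnn _).
  by rewrite sub0r normrN; apply: le_trans; exact: ler_norm.
exists phi; split; first by move=> n; case: (Hphi n).
have cv : 2 * n.+1%:R^-1 + 2 * normf (s n - x) (s n - x) @[n --> \oo] --> 0.
  rewrite -[X in _ --> X](_ : 2 * 0 + 2 * 0 = 0); last by ring.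
  by apply: cvgD; apply: cvgM => //; [exact: cvg_cst|exact: cvg_harmonic|exact: cvg_cst].
apply: (squeeze_cvgr _ (cvg_cst 0) cv); apply: nearW => n /=.
have [tp pn] := Hphi n; have tg := triple_grad _ tp.
rewrite (psd_ge0 psd_normf)/=; last exact: linsubB.
apply: (le_trans (psd_quadB_le2 sT psd_normf _ _ (s n) tg tx (ts n))).
by rewrite lerD2r ler_wpM2l.
Qed.
End DegenerateSpace.

(** * Poincare inequality on cells *)

Section Cells.
Context {R : realType}.
Notation T2 := (measurableTypeR R * measurableTypeR R)%type.
Notation leb := (@lebesgue_measure R).

Lemma is_derive_slice1 (f : R * R -> R) s t : derivable f (s, t) e1 ->
  is_derive s 1 (fun r => f (r, t)) ('D_e1 f (s, t)).
Proof.
move=> df.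
have E : (fun k : R => k^-1 *: (((fun r => f (r, t)) \o shift s) (k *: 1) - f (s, t)))
    = (fun k : R => k^-1 *: ((f \o shift (s, t)) (k *: e1) - f (s, t))).
  apply/funext => k.
  change (k^-1 *: (f (k * 1 + s, t) - f (s, t)) =
    k^-1 *: (f (k * 1 + s, k * 0 + t) - f (s, t))).
  by rewrite mulr0 add0r.
by split; [rewrite /derivable E|rewrite /derive E].
Qed.

Lemma is_derive_slice2 (f : R * R -> R) s t : derivable f (s, t) e2 ->
  is_derive t 1 (fun r => f (s, r)) ('D_e2 f (s, t)).
Proof.
move=> df.
have E : (fun k : R => k^-1 *: (((fun r => f (s, r)) \o shift t) (k *: 1) - f (s, t)))
    = (fun k : R => k^-1 *: ((f \o shift (s, t)) (k *: e2) - f (s, t))).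
  apply/funext => k.
  change (k^-1 *: (f (s, k * 1 + t) - f (s, t)) =
    k^-1 *: (f (k * 0 + s, k * 1 + t) - f (s, t))).
  by rewrite mulr0 add0r.
by split; [rewrite /derivable E|rewrite /derive E].
Qed.

(** Fundamental theorem of calculus, then Cauchy-Schwarz against the constant 1. Only the open
    interval must lie in I: in the edge cells s = 0 is outside the cell. *)
Lemma increment_sq_le_lt (f f' : R -> R) (I : set R) (r s t : R) :
  (forall x : R, is_derive x 1 f (f' x)) -> continuous f' -> measurable I ->
  s < t -> t - s <= r -> `]s, t[ `<=` I ->
  (((f t - f s) ^+ 2)%:E <= r%:E * \int[leb]_(x in I) ((f' x) ^+ 2)%:E)%E.
Proof.
move=> df cf' mI st tsr stI.
have cf : continuous f.
  move=> x; apply/differentiable_continuous/derivable1_diffP.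
  exact: (@ex_derive _ _ _ _ _ _ _ (df x)).
have mf' : measurable_fun setT f' by exact: continuous_measurable_fun.
have ftc : (\int[leb]_(x in `[s, t]) (f' x)%:E = (f t)%:E - (f s)%:E)%E.
  apply: continuous_FTC2 => //.
  - exact: continuous_subspaceT.
  - split.
    + by move=> x _; exact: (@ex_derive _ _ _ _ _ _ _ (df x)).
    + by apply: cvg_at_right_filter; exact: cf.
    + by apply: cvg_at_left_filter; exact: cf.
  - by move=> x _; rewrite derive1E (@derive_val _ _ _ _ _ _ _ (df x)).
pose D : set R := `[s, t]%classic.
have mD : measurable (D : set (measurableTypeR R)) by exact: measurable_itv.
have Dts : leb D = (t - s)%:E by rewrite lebesgue_measure_itv /= lte_fin st.
have Doo : (leb D < +oo)%E by rewrite Dts ltry.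
have sf' : sqint (mu := leb) (D := D) f'.
  have /compact_bounded[C [_ HC]] := continuous_compact (continuous_subspaceT cf')
    (@segment_compact R s t).
  apply: (sqint_bounded mD f' (C + 1)); first exact: Doo.
    exact: measurable_funTS.
  by move=> x Dx; apply: (HC (C + 1)); [rewrite ltrDl|exists x].
have s1 : sqint (mu := leb) (D := D) (cst 1).
  apply: (sqint_bounded mD (cst 1) 1); first exact: Doo.
    exact: measurable_cst.
  by move=> x _; rewrite normr1.
have := psd_CS (linsub_sqint mD) (psd_ip mD) _ _ sf' s1.
have -> : ip (mu := leb) (D := D) f' (cst 1) = f t - f s.
  rewrite /ip /Rintegral; under eq_integral do rewrite mulr1.
  by rewrite ftc.
have -> : ip (mu := leb) (D := D) (cst 1) (cst 1) = t - s.
  rewrite /ip /Rintegral (eq_integral (cst 1%E)); last by move=> x _; rewrite /= mulr1.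
  by rewrite integral_cst// mul1e; exact: (congr1 fine Dts).
rewrite -lee_fin [leRHS]EFinM -(ip_sqrE mD _ sf') => H; apply: (le_trans H).
rewrite muleC; apply: lee_pmul => //.
- by rewrite lee_fin subr_ge0 ltW.
- by apply: integral_ge0 => x _; rewrite lee_fin sqr_ge0.
- have mf2 : measurable_fun setT (fun x => (f' x ^+ 2)%:E).
    by apply/measurable_EFinP; exact: measurable_funX.
  rewrite -integral_itv_obnd_cbnd; last first.
    exact: measurable_funTS.
  rewrite -integral_itv_bndo_bndc; last first.
    exact: measurable_funTS.
  apply: ge0_subset_integral => //; [exact: measurable_funTS|].
  by move=> x _; rewrite lee_fin sqr_ge0.
Qed.

Lemma increment_sq_le (f f' : R -> R) (I : set R) (r s t : R) :
  (forall x : R, is_derive x 1 f (f' x)) -> continuous f' -> measurable I ->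
  `|t - s| <= r -> `]s, t[ `<=` I -> `]t, s[ `<=` I ->
  (((f t - f s) ^+ 2)%:E <= r%:E * \int[leb]_(x in I) ((f' x) ^+ 2)%:E)%E.
Proof.
move=> df cf' mI; rewrite ler_norml => /andP[H1 H2] stI tsI.
have [st|ts|->] := ltgtP s t.
- exact: increment_sq_le_lt.
- by rewrite -sqrrN opprB; apply: increment_sq_le_lt => //; lra.
- rewrite subrr expr0n /=; apply: mule_ge0; first by rewrite lee_fin; lra.
  by apply: integral_ge0 => x _; rewrite lee_fin sqr_ge0.
Qed.

Lemma nu_tonelli1 (F : T2 -> \bar R) : measurable_fun setT F ->
  (forall x, (0 <= F x)%E) ->
  (\int[nu]_x F x = \int[leb]_s \int[leb]_t F (s, t))%E.
Proof. move=> mF F0; exact: (fubini_tonelli1 F mF F0). Qed.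

Lemma nu_tonelli2 (F : T2 -> \bar R) : measurable_fun setT F ->
  (forall x, (0 <= F x)%E) ->
  (\int[nu]_x F x = \int[leb]_t \int[leb]_s F (s, t))%E.
Proof.
move=> mF F0; rewrite nu_tonelli1//.
exact: (@fubini_tonelli _ _ _ _ _ leb leb F mF F0).
Qed.

Section Tonelli.
Variables (F : T2 -> \bar R) (I J : set (measurableTypeR R)).
Hypotheses (mF : measurable_fun setT F) (F0 : forall x, (0 <= F x)%E).
Hypotheses (mI : measurable I) (mJ : measurable J).

Let mFIJ : measurable_fun setT (F \_ (I `*` J)).
Proof. by apply/(measurable_restrictT _ (measurableX mI mJ)); exact: measurable_funTS. Qed.

Let FIJ0 x : (0 <= (F \_ (I `*` J)) x)%E.
Proof. by rewrite patchE; case: ifP. Qed.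

Lemma tonelli_rect1 :
  (\int[nu]_(x in I `*` J) F x = \int[leb]_(s in I) \int[leb]_(t in J) F (s, t))%E.
Proof.
rewrite integral_mkcond nu_tonelli1// [RHS]integral_mkcond.
apply: eq_integral => s _; rewrite [RHS]patchE; case: ifPn => sI.
  rewrite [RHS]integral_mkcond; apply: eq_integral => t _; rewrite !patchE.
  by rewrite in_setX sI.
by apply: integral0_eq => t _; rewrite patchE in_setX (negPf sI).
Qed.

Lemma tonelli_rect2 :
  (\int[nu]_(x in I `*` J) F x = \int[leb]_(t in J) \int[leb]_(s in I) F (s, t))%E.
Proof.
rewrite integral_mkcond nu_tonelli2// [RHS]integral_mkcond.
apply: eq_integral => t _; rewrite [RHS]patchE; case: ifPn => tJ.
  rewrite [RHS]integral_mkcond; apply: eq_integral => s _; rewrite !patchE.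
  by rewrite in_setX tJ andbT.
by apply: integral0_eq => s _; rewrite patchE in_setX (negPf tJ) andbF.
Qed.
End Tonelli.

Lemma measurable_slice1 (F : T2 -> \bar R) (I : set (measurableTypeR R)) :
  measurable_fun setT F -> (forall x, (0 <= F x)%E) -> measurable I ->
  measurable_fun [set: T2] (fun x => \int[leb]_(s in I) F (s, x.2))%E.
Proof.
move=> mF F0 mI.
have -> : (fun x : T2 => \int[leb]_(s in I) F (s, x.2))%E =
   fubini_G leb (F \_ (I `*` setT)) \o snd.
  apply/funext => x; rewrite /= /fubini_G [LHS]integral_mkcond; apply: eq_integral => s _.
  by rewrite !patchE in_setX in_setT andbT.
apply: measurableT_comp => //; apply: measurable_fun_fubini_tonelli_G.
- by apply/(measurable_restrictT _ (measurableX mI measurableT)); exact: measurable_funTS.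
- by move=> x; rewrite patchE; case: ifP.
Qed.

Lemma measurable_slice2 (F : T2 -> \bar R) (J : set (measurableTypeR R)) :
  measurable_fun setT F -> (forall x, (0 <= F x)%E) -> measurable J ->
  measurable_fun [set: T2] (fun x => \int[leb]_(t in J) F (x.1, t))%E.
Proof.
move=> mF F0 mJ.
have -> : (fun x : T2 => \int[leb]_(t in J) F (x.1, t))%E =
   fubini_F leb (F \_ (setT `*` J)) \o fst.
  apply/funext => x; rewrite /= /fubini_F [LHS]integral_mkcond; apply: eq_integral => s _.
  by rewrite !patchE in_setX in_setT.
apply: measurableT_comp => //; apply: measurable_fun_fubini_tonelli_F.
- by apply/(measurable_restrictT _ (measurableX measurableT mJ)); exact: measurable_funTS.
- by move=> x; rewrite patchE; case: ifP.
Qed.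

(** The inner integral does not depend on x.1, so by Tonelli integration over I merely multiplies by
    its length. *)
Lemma integral_slice1 (F : T2 -> \bar R) (I J : set (measurableTypeR R)) :
  measurable_fun setT F -> (forall x, (0 <= F x)%E) -> measurable I -> measurable J ->
  (\int[nu]_(x in I `*` J) \int[leb]_(s in I) F (s, x.2)
    = leb I * \int[nu]_(x in I `*` J) F x)%E.
Proof.
move=> mF F0 mI mJ.
have G0 t : (0 <= \int[leb]_(s in I) F (s, t))%E by exact: integral_ge0.
have mG := measurable_slice1 F I mF F0 mI.
have mGt : measurable_fun setT (fun t => \int[leb]_(s in I) F (s, t))%E.
  have := measurableT_comp mG
    (@measurable_pair1 _ _ (measurableTypeR R) (measurableTypeR R) (0 : R)).
  exact.
rewrite (tonelli_rect2 _ I J mG)//= (tonelli_rect2 F I J)//.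
rewrite -ge0_integralZl//; last exact: measurable_funTS.
by apply: eq_integral => t _; rewrite integral_cst// muleC.
Qed.

Lemma integral_slice2 (F : T2 -> \bar R) (I J : set (measurableTypeR R)) :
  measurable_fun setT F -> (forall x, (0 <= F x)%E) -> measurable I -> measurable J ->
  (\int[nu]_(x in I `*` J) \int[leb]_(t in J) F (x.1, t)
    = leb J * \int[nu]_(x in I `*` J) F x)%E.
Proof.
move=> mF F0 mI mJ.
have G0 t : (0 <= \int[leb]_(s in J) F (t, s))%E by exact: integral_ge0.
have mG := measurable_slice2 F J mF F0 mJ.
have mGt : measurable_fun setT (fun t => \int[leb]_(s in J) F (t, s))%E.
  have := measurableT_comp mG
    (@measurable_pair2 _ _ (measurableTypeR R) (measurableTypeR R) (0 : R)).
  exact.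
rewrite (tonelli_rect1 _ I J mG)//= (tonelli_rect1 F I J)//.
rewrite -ge0_integralZl//; last exact: measurable_funTS.
by apply: eq_integral => t _; rewrite integral_cst// muleC.
Qed.
End Cells.

(** * Poincare inequality on one rectangle *)

Section Poincare.
Context {R : realType}.
Notation T2 := (measurableTypeR R * measurableTypeR R)%type.
Notation leb := (@lebesgue_measure R).

Definition short (I : set R) (r : R) := [/\ measurable (I : set (measurableTypeR R)),
  I `<=` `]0, 1[, (leb I <= r%:E)%E
  & forall s t, I s -> I t -> `|t - s| <= r /\ `]s, t[ `<=` I].

Section OneCell.
Variables (phi phi1 phi2 : R * R -> R) (I J : set (measurableTypeR R)) (r r' : R).
Hypotheses (cphi : continuous phi) (cphi1 : continuous phi1) (cphi2 : continuous phi2).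
Hypothesis deriv1 : forall (t s : R), is_derive s 1 (fun s => phi (s, t)) (phi1 (s, t)).
Hypothesis deriv2 : forall (s t : R), is_derive t 1 (fun t => phi (s, t)) (phi2 (s, t)).
Hypotheses (r0 : 0 <= r) (r'0 : 0 <= r') (Ir : short I r) (Jr : short J r').
Let Q : set T2 := I `*` J.
Notation ipQ := (ip (mu := nu) (D := Q)).
Notation sqintQ := (sqint (mu := nu) (D := Q)).

Let mI : measurable I. Proof. by case: Ir. Qed.
Let mJ : measurable J. Proof. by case: Jr. Qed.
Let mQ : measurable Q. Proof. exact: measurableX. Qed.
Let QOm : Q `<=` Om.
Proof.
have [_ I1 _ _] := Ir; have [_ J1 _ _] := Jr.
by move=> x [/I1 + /J1]; rewrite /Om /= !in_itv /=.
Qed.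
Let Qoo : (nu Q < +oo)%E.
Proof.
apply: le_lt_trans nu_Om; apply: le_measure; rewrite ?inE//; exact: measurable_Om.
Qed.

Let sQ f : continuous f -> sqintQ f.
Proof.
move=> cf; have [C HC] := continuous_bounded_Om f cf.
apply: (sqint_bounded mQ f C Qoo); last by move=> x /QOm; exact: HC.
by apply: measurable_funTS; exact: continuous_measurable2.
Qed.

Let sq_meas (f : R * R -> R) : continuous f ->
  measurable_fun [set: T2] (fun x => (f x ^+ 2)%:E).
Proof.
move=> cf; apply/measurable_EFinP; apply: measurable_funX.
exact: continuous_measurable2.
Qed.

Let A t := (\int[leb]_(s in I) ((phi1 (s, t)) ^+ 2)%:E)%E.
Let B s := (\int[leb]_(t in J) ((phi2 (s, t)) ^+ 2)%:E)%E.
Let A0 t : (0 <= A t)%E. Proof. by apply: integral_ge0 => x _; rewrite lee_fin sqr_ge0. Qed.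
Let B0 t : (0 <= B t)%E. Proof. by apply: integral_ge0 => x _; rewrite lee_fin sqr_ge0. Qed.
Let p0 := ipQ phi phi.
Let p1 := ipQ phi1 phi1.
Let p2 := ipQ phi2 phi2.

Let mA : measurable_fun [set: T2] (fun x => A x.2).
Proof.
apply: (measurable_slice1 (fun x : T2 => ((phi1 x) ^+ 2)%:E) I (sq_meas phi1 cphi1)) => //.
by move=> x; rewrite lee_fin sqr_ge0.
Qed.

Let mB : measurable_fun [set: T2] (fun x => B x.1).
Proof.
apply: (measurable_slice2 (fun x : T2 => ((phi2 x) ^+ 2)%:E) J (sq_meas phi2 cphi2)) => //.
by move=> x; rewrite lee_fin sqr_ge0.
Qed.

Let intA : (\int[nu]_(x in Q) A x.2 <= (r * p1)%:E)%E.
Proof.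
have F0 (x : T2) : (0 <= (phi1 x ^+ 2)%:E)%E by rewrite lee_fin sqr_ge0.
rewrite [leLHS](integral_slice1 (fun x : T2 => ((phi1 x) ^+ 2)%:E) I J
  (sq_meas phi1 cphi1) F0 mI mJ).
rewrite -/Q (ip_sqrE mQ _ (sQ _ cphi1)) EFinM; apply: lee_wpmul2r; last by case: Ir.
by rewrite lee_fin (psd_ge0 (psd_ip mQ))//; exact: sQ.
Qed.

Let intB : (\int[nu]_(x in Q) B x.1 <= (r' * p2)%:E)%E.
Proof.
have F0 (x : T2) : (0 <= (phi2 x ^+ 2)%:E)%E by rewrite lee_fin sqr_ge0.
rewrite [leLHS](integral_slice2 (fun x : T2 => ((phi2 x) ^+ 2)%:E) I J
  (sq_meas phi2 cphi2) F0 mI mJ).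
rewrite -/Q (ip_sqrE mQ _ (sQ _ cphi2)) EFinM; apply: lee_wpmul2r; last by case: Jr.
by rewrite lee_fin (psd_ge0 (psd_ip mQ))//; exact: sQ.
Qed.

Let cont1 t : continuous (fun s => phi1 (s, t)).
Proof.
move=> s; have p : (u, t) @[u --> s] --> (s, t).
  by apply: (@cvg_pair _ _ _ (nbhs s) (nbhs s) (nbhs t) _ _ _ id (fun=> t));
    [exact: cvg_id|exact: cvg_cst].
exact: (cvg_comp _ _ p (cphi1 (s, t))).
Qed.

Let cont2 s : continuous (fun t => phi2 (s, t)).
Proof.
move=> t; have p : (s, u) @[u --> t] --> (s, t).
  by apply: (@cvg_pair _ _ _ (nbhs t) (nbhs s) (nbhs t) _ _ _ (fun=> s) id);
    [exact: cvg_cst|exact: cvg_id].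
exact: (cvg_comp _ _ p (cphi2 (s, t))).
Qed.

(** Path from y vertically to (y.1, x.2), then horizontally to x. The horizontal cost depends on x
    alone and the vertical one on y alone, so each can be integrated separately. *)
Let oscillation x y : Q x -> Q y ->
  (((phi x - phi y) ^+ 2)%:E <= (2 * r)%:E * A x.2 + (2 * r')%:E * B y.1)%E.
Proof.
case: x y => x1 x2 [y1 y2] [/= Ix1 Jx2] [/= Iy1 Jy2].
have [_ _ _ Ic] := Ir; have [_ _ _ Jc] := Jr.
have [d1 s1] := Ic y1 x1 Iy1 Ix1; have [_ s1'] := Ic x1 y1 Ix1 Iy1.
have [d2 s2] := Jc y2 x2 Jy2 Jx2; have [_ s2'] := Jc x2 y2 Jx2 Jy2.
have H1 := increment_sq_le _ _ I r y1 x1 (deriv1 x2) (cont1 x2) mI d1 s1 s1'.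
have H2 := increment_sq_le _ _ J r' y2 x2 (deriv2 y1) (cont2 y1) mJ d2 s2 s2'.
pose u := phi (x1, x2) - phi (y1, x2); pose v := phi (y1, x2) - phi (y1, y2).
apply: (@le_trans _ _ (2%:E * (u ^+ 2)%:E + 2%:E * (v ^+ 2)%:E)%E).
  rewrite -!EFinM -EFinD lee_fin (_ : phi _ - phi _ = u + v); last by rewrite /u /v; ring.
  by have := sqr_ge0 (u - v); rewrite !expr2; nra.
rewrite !EFinM -!muleA; apply: leeD; apply: lee_wpmul2l => //.
Qed.

Let q := fine (nu Q).
Let qE : nu Q = q%:E. Proof. by rewrite /q fineK// ge0_fin_numE. Qed.
Let q0 : 0 <= q. Proof. exact: fine_ge0. Qed.
Let p1ge0 : 0 <= p1. Proof. exact: (psd_ge0 (psd_ip mQ) _ (sQ _ cphi1)). Qed.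
Let p2ge0 : 0 <= p2. Proof. exact: (psd_ge0 (psd_ip mQ) _ (sQ _ cphi2)). Qed.

Let oscillation_mean x : Q x ->
  (\int[nu]_(y in Q) ((phi x - phi y) ^+ 2)%:E
    <= (2 * r * q)%:E * A x.2 + (2 * r' ^+ 2 * p2)%:E)%E.
Proof.
move=> Qx.
have mBQ : measurable_fun Q (fun y : T2 => (2 * r')%:E * B y.1)%E.
  apply: emeasurable_funM; first exact: measurable_cst.
  exact: measurable_funTS.
have c0 : (0 <= (2 * r)%:E * A x.2)%E by rewrite mule_ge0// lee_fin mulr_ge0.
have cB y : (0 <= (2 * r')%:E * B y)%E by rewrite mule_ge0// lee_fin mulr_ge0.
apply: (@le_trans _ _ (\int[nu]_(y in Q) ((2 * r)%:E * A x.2 + (2 * r')%:E * B y.1))%E).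
  apply: ge0_le_integral => //.
  - by move=> y _; rewrite lee_fin sqr_ge0.
  - apply/measurable_EFinP; apply: measurable_funX; apply: measurable_funB => //.
    by apply: measurable_funTS; exact: continuous_measurable2.
  - by apply: emeasurable_funD => //; exact: measurable_cst.
  - by move=> y Qy; exact: oscillation.
rewrite ge0_integralD//; last first.
rewrite integral_cst// [X in (_ * X)%E]qE muleAC -EFinM.
apply: leeD; first by rewrite mulrAC.
rewrite ge0_integralZl//.
- apply: (@le_trans _ _ ((2 * r')%:E * (r' * p2)%:E)%E).
    by apply: lee_wpmul2l => //; rewrite lee_fin mulr_ge0.
  by rewrite -EFinM lee_fin expr2 !mulrA.
- exact: measurable_funTS.
- by rewrite lee_fin mulr_ge0.
Qed.

Let m := Rintegral nu Q phi.

(** q phi(x) - m is the integral over y of phi(x) - phi(y). Cauchy-Schwarz bounds its square by q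
    times the mean oscillation, and q^2 phi^2 <= 2 m^2 + 2 (q phi - m)^2. *)
Let point_bound x : Q x ->
  ((q ^+ 2 * phi x ^+ 2)%:E
    <= (2 * m ^+ 2 + 4 * q * r' ^+ 2 * p2)%:E + (4 * r * q ^+ 2)%:E * A x.2)%E.
Proof.
move=> Qx.
have s1 : sqintQ (cst 1).
  by apply: (sqint_bounded mQ (cst 1) 1 Qoo) => // y _; rewrite normr1.
have sg : sqintQ (phi x *: cst 1 - phi).
  apply: linsubB; [exact: linsub_sqint|apply: linsubZ => //; exact: linsub_sqint|exact: sQ].
have e11 : ipQ (cst 1) (cst 1) = q.
  rewrite /ip /Rintegral (eq_integral (cst 1%E)); last by move=> y _; rewrite /= mulr1.
  by rewrite integral_cst// mul1e.
have em : ipQ phi (cst 1) = m.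
  by rewrite /m /ip; apply: eq_Rintegral => y _; rewrite mulr1.
have eg : ipQ (phi x *: cst 1 - phi) (cst 1) = phi x * q - m.
  rewrite (psdBl (psd_ip mQ))//; first last.
  - exact: sQ.
  - by apply: linsubZ => //; exact: linsub_sqint.
  by rewrite (psdZl (linsub_sqint mQ) (psd_ip mQ))// e11 em.
have H := psd_CS (linsub_sqint mQ) (psd_ip mQ) _ _ sg s1.
rewrite e11 eg in H.
have gE : (ipQ (phi x *: cst 1 - phi) (phi x *: cst 1 - phi))%:E =
    (\int[nu]_(y in Q) ((phi x - phi y) ^+ 2)%:E)%E.
  rewrite -(ip_sqrE mQ _ sg); apply: eq_integral => y _; congr (_ ^+ 2)%:E.
  by change (phi x * 1 - phi y = phi x - phi y); rewrite mulr1.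
set G := ipQ (phi x *: cst 1 - phi) (phi x *: cst 1 - phi) in H gE.
apply: (@le_trans _ _ ((2 * m ^+ 2)%:E + (2 * q)%:E * G%:E)%E).
  rewrite -EFinM -EFinD lee_fin.
  have aux (a b c d : R) : (a * c - d) ^+ 2 <= b * c ->
      c ^+ 2 * a ^+ 2 <= 2 * d ^+ 2 + 2 * c * b.
    by have := sqr_ge0 (a * c - d - d); rewrite !expr2; nra.
  exact: aux.
rewrite gE; apply: (@le_trans _ _ ((2 * m ^+ 2)%:E +
    (2 * q)%:E * ((2 * r * q)%:E * A x.2 + (2 * r' ^+ 2 * p2)%:E))%E).
  rewrite leeD2l//; apply: lee_wpmul2l; first by rewrite lee_fin mulr_ge0.
  exact: oscillation_mean.
rewrite ge0_muleDr; last 2 first.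
- by rewrite mule_ge0// lee_fin !mulr_ge0.
- by rewrite lee_fin !mulr_ge0// ?sqr_ge0.
rewrite muleA -!EFinM addeCA addeC -EFinD.
rewrite le_eqVlt; apply/orP; left; apply/eqP; congr (_%:E + _%:E * _)%E; ring.
Qed.

(** [point_bound] integrated over x and divided by q^2; a null cell is covered by 2 / 0 = 0. The two
    side lengths stay separate because only the vertical derivative carries the weight h. *)
Lemma cell_poincare : p0 <= 2 / q * m ^+ 2 + 4 * r ^+ 2 * p1 + 4 * r' ^+ 2 * p2.
Proof.
have [q00|qn0] := eqVneq q 0.
  have -> : p0 = 0.
    rewrite /p0 /ip /Rintegral null_set_integral//; last by rewrite [LHS]qE q00.
    exact: (measurable_int nu (sqint_mul_integrable mQ _ _ (sQ _ cphi) (sQ _ cphi))).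
  rewrite q00 invr0 mulr0 mul0r add0r.
  by apply: addr_ge0; apply: mulr_ge0 => //; apply: mulr_ge0 => //; exact: sqr_ge0.
have qp : 0 < q by rewrite lt_neqAle eq_sym qn0.
pose K := 2 * m ^+ 2 + 4 * q * r' ^+ 2 * p2.
have K0 : 0 <= K.
  apply: addr_ge0; first by apply: mulr_ge0 => //; exact: sqr_ge0.
  by rewrite !mulr_ge0.
have cA x : (0 <= (4 * r * q ^+ 2)%:E * A x)%E by rewrite mule_ge0// lee_fin !mulr_ge0// ?sqr_ge0.
have mAQ : measurable_fun Q (fun x : T2 => (4 * r * q ^+ 2)%:E * A x.2)%E.
  apply: emeasurable_funM; first exact: measurable_cst.
  exact: measurable_funTS.
have H : ((q ^+ 2 * p0)%:E <= (K * q + 4 * r * q ^+ 2 * (r * p1))%:E)%E.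
  rewrite EFinM -(ip_sqrE mQ _ (sQ _ cphi)) -ge0_integralZl//; last 3 first.
  - by apply: measurable_funTS; exact: sq_meas.
  - by move=> x _; rewrite lee_fin sqr_ge0.
  - by rewrite lee_fin sqr_ge0.
  apply: (@le_trans _ _ (\int[nu]_(x in Q) (K%:E + (4 * r * q ^+ 2)%:E * A x.2))%E).
    apply: ge0_le_integral => //.
    - by move=> x _; rewrite -EFinM lee_fin mulr_ge0// sqr_ge0.
    - apply: emeasurable_funM; first exact: measurable_cst.
      by apply: measurable_funTS; exact: sq_meas.
    - by apply: emeasurable_funD => //; exact: measurable_cst.
  rewrite ge0_integralD//.
  rewrite integral_cst// [X in (_ * X)%E]qE -EFinM EFinD leeD2l//.
  rewrite ge0_integralZl//; last 2 first.
  - exact: measurable_funTS.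
  - by rewrite lee_fin !mulr_ge0// ?sqr_ge0.
  rewrite [leRHS]EFinM; apply: lee_wpmul2l => //.
  by rewrite lee_fin !mulr_ge0// ?sqr_ge0.
rewrite lee_fin /K in H.
rewrite -(ler_pM2l (exprn_gt0 2 qp)); apply: (le_trans H).
by rewrite le_eqVlt; apply/orP; left; apply/eqP; field.
Qed.

(* Only the x.1-derivative enters, so the degeneracy of h at x.1 = 0 is harmless
   in these cells. *)
Lemma edge_cell_poincare : (forall t, phi (0, t) = 0) ->
  (forall t, I t -> t <= r /\ `]0, t[ `<=` I) ->
  p0 <= r ^+ 2 * p1.
Proof.
move=> phi0 Ie.
have pt x : Q x -> ((phi x ^+ 2)%:E <= r%:E * A x.2)%E.
  case: x => x1 x2 [/= Ix1 _]; have [x1r x1I] := Ie x1 Ix1.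
  have x10 : 0 < x1 by have [_ /(_ x1 Ix1)/=] := Ir; rewrite in_itv /= => /andP[].
  have := increment_sq_le_lt _ _ I r 0 x1 (deriv1 x2) (cont1 x2) mI x10.
  by rewrite phi0 !subr0; exact.
rewrite -lee_fin -(ip_sqrE mQ _ (sQ _ cphi)).
apply: (@le_trans _ _ (\int[nu]_(x in Q) (r%:E * A x.2))%E).
  apply: ge0_le_integral => //.
  - by move=> x _; rewrite lee_fin sqr_ge0.
  - by apply: measurable_funTS; exact: sq_meas.
  - apply: emeasurable_funM; first exact: measurable_cst.
    exact: measurable_funTS.
rewrite ge0_integralZl//; last exact: measurable_funTS.
by rewrite expr2 -mulrA EFinM; apply: lee_wpmul2l.
Qed.
End OneCell.
End Poincare.

(** * Compactness of the mass form *)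

Section Grid.
Context {R : realType}.
Notation T2 := (measurableTypeR R * measurableTypeR R)%type.
Notation leb := (@lebesgue_measure R).

(** Half-open pieces tile without overlap; the intersection removes the point 1 from the last
    one. *)
Definition seg (n i : nat) : set R :=
  `]i%:R / n.+1%:R, i.+1%:R / n.+1%:R]%classic `&` `]0, 1[%classic.

Lemma segP n i x : seg n i x <->
  [/\ i%:R / n.+1%:R < x, x <= i.+1%:R / n.+1%:R & 0 < x < 1].
Proof. by rewrite /seg /= !in_itv /=; split => [[/andP[]]|[-> ->]]. Qed.

Lemma measurable_seg n i : measurable (seg n i : set (measurableTypeR R)).
Proof. by apply: measurableI; exact: measurable_itv. Qed.

Lemma seg_width n i : i.+1%:R / n.+1%:R - i%:R / n.+1%:R = n.+1%:R^-1 :> R.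
Proof. by rewrite -mulrBl -natr1 addrAC subrr add0r mul1r. Qed.

Lemma seg_short n i : short (seg n i) n.+1%:R^-1.
Proof.
split.
- exact: measurable_seg.
- by move=> x [].
- apply: (@le_trans _ _ (leb `]i%:R / n.+1%:R, i.+1%:R / n.+1%:R]%classic)).
    apply: le_measure; rewrite ?inE; [exact: measurable_seg|exact: measurable_itv|].
    by move=> x [].
  rewrite lebesgue_measure_itv /= lte_fin ltr_pM2r ?invr_gt0// ltr_nat ltnSn.
  by rewrite -EFinB lee_fin seg_width.
- move=> s t /segP[s1 s2 /andP[s3 s4]] /segP[t1 t2 /andP[t3 t4]]; split.
    rewrite -(seg_width n i) ler_norml; move: s1 s2 t1 t2.
    by move: (i%:R / n.+1%:R) (i.+1%:R / n.+1%:R) => a b *; apply/andP; split; lra.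
  move=> x; rewrite /= in_itv /= => /andP[x1 x2]; apply/segP; move: s1 s2 t1 t2.
  move: (i%:R / n.+1%:R) (i.+1%:R / n.+1%:R) => a b *.
  by split; [lra|lra|apply/andP; split; lra].
Qed.

Lemma seg_edge n t : seg n 0 t -> t <= n.+1%:R^-1 /\ `]0, t[ `<=` seg n 0.
Proof.
move=> /segP[]; rewrite mul0r mul1r => _ t1 /andP[t2 t3]; split => // x.
rewrite /= in_itv /= => /andP[x1 x2]; apply/segP; rewrite mul0r mul1r.
move: t1; move: (n.+1%:R^-1) => a t1.
by split; [lra|lra|apply/andP; split; lra].
Qed.

Lemma seg_cover n x : 0 < x < 1 -> exists i : 'I_n.+1, seg n i x.
Proof.
move=> /andP[x0 x1].
have n0 : 0 < n.+1%:R :> R by [].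
have ex : exists k, x <= k.+1%:R / n.+1%:R.
  by exists n; rewrite divff ?gt_eqF// ltW.
case: (ex_minnP ex) => k xk kmin.
have kn : (k < n.+1)%N by rewrite ltnS; apply: kmin; rewrite divff ?gt_eqF// ltW.
exists (Ordinal kn); apply/segP; split => //=; last by rewrite x0.
case: k xk kmin kn => [|k] xk kmin kn; first by rewrite mul0r.
by rewrite ltNge; apply/negP => /kmin; rewrite ltnn.
Qed.

Lemma seg_inj n i j x : seg n i x -> seg n j x -> i = j.
Proof.
move=> /segP[i1 i2 _] /segP[j1 j2 _].
have n0 : 0 < n.+1%:R :> R by [].
have := lt_le_trans i1 j2; have := lt_le_trans j1 i2.
rewrite !ltr_pM2r ?invr_gt0// !ltr_nat !ltnS => ji ij.
by apply/eqP; rewrite eqn_leq ij ji.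
Qed.

Definition cell n n' (p : 'I_n.+1 * 'I_n'.+1) : set T2 := seg n p.1 `*` seg n' p.2.

Lemma measurable_cell n n' p : measurable (cell n n' p).
Proof. by apply: measurableX; exact: measurable_seg. Qed.

Lemma cell_Om n n' p : cell n n' p `<=` Om.
Proof. by move=> x [/segP[_ _ ?] /segP[_ _ ?]]. Qed.

Lemma integral_cells n n' (F : T2 -> \bar R) : measurable_fun Om F ->
  (forall x, Om x -> (0 <= F x)%E) ->
  (\int[nu]_(x in Om) F x = \sum_p \int[nu]_(x in cell n n' p) F x)%E.
Proof.
move=> mF F0.
have cov : Om = \big[setU/set0]_(p <- index_enum ('I_n.+1 * 'I_n'.+1)%type) cell n n' p.
  rewrite -bigcup_seq; apply/seteqP; split => [x [x1 x2]|x [p _]]; last exact: cell_Om.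
  have [i ix] := seg_cover n x.1 x1; have [j jx] := seg_cover n' x.2 x2.
  by exists (i, j) => //=; rewrite mem_index_enum.
rewrite [in LHS]cov ge0_integral_bigsetU//.
- by move=> p; exact: measurable_cell.
- exact: index_enum_uniq.
- move=> [i j] [i' j'] _ _ [x [[/= ix jx] [/= ix' jx']]].
  by congr (_, _); apply: val_inj; [exact: seg_inj ix ix'|exact: seg_inj jx jx'].
- by rewrite -cov.
- by rewrite -cov.
Qed.

Lemma sqint_cell n n' p (f : R * R -> R) : sqint (mu := nu) (D := Om) f ->
  sqint (mu := nu) (D := cell n n' p) f.
Proof.
move=> [mf foo]; split.
  by apply: measurable_funS mf; [exact: measurable_Om|exact: cell_Om].
apply: le_lt_trans foo; apply: ge0_subset_integral.
- exact: measurable_cell.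
- exact: measurable_Om.
- by apply/measurable_EFinP; exact: measurable_funX.
- by move=> x _; rewrite lee_fin sqr_ge0.
- exact: cell_Om.
Qed.

Lemma ip_cells n n' (f : R * R -> R) : sqint (mu := nu) (D := Om) f ->
  ip (mu := nu) (D := Om) f f = \sum_p ip (mu := nu) (D := cell n n' p) f f.
Proof.
move=> sf; apply: EFin_inj; rewrite -(ip_sqrE measurable_Om _ sf).
rewrite (integral_cells n n').
- rewrite -sumEFin; apply: eq_bigr => p _.
  by rewrite (ip_sqrE (measurable_cell n n' p) _ (sqint_cell n n' p f sf)).
- by apply/measurable_EFinP; apply: measurable_funX; exact: sf.1.
- by move=> x _; rewrite lee_fin sqr_ge0.
Qed.
End Grid.

Section Compactness.
Context {R : realType}.
Variable h : R -> R.
Notation T2 := (measurableTypeR R * measurableTypeR R)%type.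
Notation F := (R * R -> R).
Notation E := (F * F * F)%type.
Notation sqintO := (sqint (mu := nu) (D := Om)).
Notation ipO := (ip (mu := nu) (D := Om)).
Notation normf := (form_add (energy h) mass).
Hypothesis h_gt0 : forall x, 0 < x < 1 -> 0 < h x.
Hypothesis h_bdd : exists B, forall x, 0 < x < 1 -> h x <= B.
Hypothesis h_meas : measurable_fun (Om : set T2) (fun z => h z.1).
Hypothesis h_low : forall r, 0 < r -> exists2 c, 0 < c & forall x, r < x < 1 -> c <= h x.

Let mOm : measurable (Om : set T2) := measurable_Om.

(** The width r <= e / 4 is chosen first, c is a lower bound of h beyond r, and the height r' <= c e
    / 4 is chosen last, so that 4 r'^2 times the unweighted vertical energy is at most e times the
    weighted one. *)
Lemma test_poincare e : 0 < e -> exists n n', forall phi : F, test_fun phi ->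
  mass (grad phi) (grad phi) <= e * energy h (grad phi) (grad phi) +
    \sum_p 2 / fine (nu (cell n n' p)) * (Rintegral nu (cell n n' p) phi) ^+ 2.
Proof.
move=> e0; have e4 : 0 < e / 4 by rewrite divr_gt0.
have [n /(_ n (leqnn n)) Hn] := small_invS _ e4.
have r0 : 0 < n.+1%:R^-1 :> R by rewrite invr_gt0.
have [c c0 hc] := h_low _ r0.
have e4c : 0 < e / 4 * c by rewrite mulr_gt0.
have [n' /(_ n' (leqnn n')) Hn'] := small_invS _ e4c.
have r'0 : 0 < n'.+1%:R^-1 :> R by rewrite invr_gt0.
exists n, n' => phi tphi.
set r : R := n.+1%:R^-1 in Hn r0 hc *; set r' : R := n'.+1%:R^-1 in Hn' r'0 *.
have r1 : r <= 1 by rewrite invf_le1// ler1n.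
have r'1 : r' <= 1 by rewrite invf_le1// ler1n.
have [tg0 tg1 _ tg2] := triple_grad h h_gt0 h_bdd h_meas phi tphi.
have cphi := test_fun_continuous phi tphi.
pose phi1 : F := 'D_e1 phi; pose phi2 : F := 'D_e2 phi.
have cphi1 : continuous phi1 := test_fun_derive_continuous phi e1 tphi.
have cphi2 : continuous phi2 := test_fun_derive_continuous phi e2 tphi.
have s2 : sqintO phi2 := sqint_continuous _ cphi2.
have d1 (t s : R) : is_derive s 1 (fun s => phi (s, t)) (phi1 (s, t)).
  by apply: is_derive_slice1; have [/(_ [::])[_ H] _] := tphi; exact: H.
have d2 (s t : R) : is_derive t 1 (fun t => phi (s, t)) (phi2 (s, t)).
  by apply: is_derive_slice2; have [/(_ [::])[_ H] _] := tphi; exact: H.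
have phi0 t : phi (0, t) = 0.
  by have [_ [K [_ KO H]]] := tphi; apply: H => /KO[]; rewrite /= ltxx.
have s0 : sqintO phi := tg0.
have s1 : sqintO phi1 := tg1.
have sw : sqintO (wt h phi2) := tg2.
rewrite -[mass _ _]/(ipO phi phi).
rewrite -[energy _ _ _]/(ipO phi1 phi1 + ipO (wt h phi2) (wt h phi2)).
clear tg0 tg1 tg2; clearbody phi1 phi2.
rewrite (ip_cells n n' phi s0) (ip_cells n n' phi1 s1) (ip_cells n n' _ sw).
rewrite -big_split /= mulr_sumr -big_split /=; apply: ler_sum => p _.
have mC := @measurable_cell R n n' p; have pC := psd_ip (mu := nu) mC.
have p1 := psd_ge0 pC _ (sqint_cell n n' p _ s1).
have p2 := psd_ge0 pC _ (sqint_cell n n' p _ s2).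
have pw := psd_ge0 pC _ (sqint_cell n n' p _ sw).
have w0 : 0 <= 2 / fine (nu (cell n n' p)) * Rintegral nu (cell n n' p) phi ^+ 2.
  by apply: mulr_ge0; [rewrite mulr_ge0// invr_ge0 fine_ge0|exact: sqr_ge0].
have S1 := @seg_short R n p.1; have S2 := @seg_short R n' p.2.
(* Side lengths are at most 1, so linear bounds control the squares. *)
have rr : r ^+ 2 <= e / 4 by rewrite expr2; nra.
have rr' : r' ^+ 2 <= e / 4 * c by rewrite expr2; nra.
(* First column: no lower bound of h is available, but phi vanishes at x.1 = 0 since its support
   lies in the open square. *)
have [pi0|pi0] := posnP p.1.
  have E t : seg n p.1 t -> t <= r /\ `]0, t[ `<=` seg n p.1.
    by rewrite pi0; exact: seg_edge.
  have H := edge_cell_poincare phi phi1 _ _ _ _ cphi cphi1 d1 (ltW r0) S1 S2 phi0 E.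
  rewrite -/(cell n n' p) in H; apply: (le_trans H).
  have : r ^+ 2 * ip (mu := nu) (D := cell n n' p) phi1 phi1 <=
      e * ip (mu := nu) (D := cell n n' p) phi1 phi1 by rewrite ler_wpM2r//; lra.
  have : 0 <= e * ip (mu := nu) (D := cell n n' p) (wt h phi2) (wt h phi2).
    by rewrite mulr_ge0// ltW.
  rewrite mulrDr; lra.
have := cell_poincare phi phi1 phi2 _ _ _ _ cphi cphi1 cphi2 d1 d2
    (ltW r0) (ltW r'0) S1 S2.
rewrite -/r -/r' -/(cell n n' p) => H; apply: (le_trans H).
(* Off the first column x.1 > r, hence h >= c on the cell. *)
have Hw : c * ip (mu := nu) (D := cell n n' p) phi2 phi2 <=
    ip (mu := nu) (D := cell n n' p) (wt h phi2) (wt h phi2).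
  rewrite -lee_fin EFinM -(ip_sqrE mC _ (sqint_cell n n' p _ s2)).
  rewrite -(ip_sqrE mC _ (sqint_cell n n' p _ sw)) -ge0_integralZl//; last 3 first.
  - apply/measurable_EFinP; apply: measurable_funX.
    exact: (sqint_cell n n' p _ s2).1.
  - by move=> x _; rewrite lee_fin sqr_ge0.
  - by rewrite lee_fin ltW.
  apply: ge0_le_integral => //.
  - by move=> x _; rewrite -EFinM lee_fin mulr_ge0 ?sqr_ge0// ltW.
  - apply: emeasurable_funM; first exact: measurable_cst.
    by apply/measurable_EFinP; apply: measurable_funX; exact: (sqint_cell n n' p _ s2).1.
  - by apply/measurable_EFinP; apply: measurable_funX; exact: (sqint_cell n n' p _ sw).1.
  - move=> x [/segP[x1 x2 x3] _]; rewrite -EFinM lee_fin /wt exprMn.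
    rewrite sqr_sqrtr; last by rewrite ltW// h_gt0.
    rewrite ler_wpM2r ?sqr_ge0//; apply: hc; case/andP: x3 => _ ->; rewrite andbT.
    apply: le_lt_trans x1; rewrite /r -[leLHS]mul1r ler_pM2r//.
    by rewrite ler1n.
move: (ip _ _) Hw p1 p2 pw w0 => *.
nra.
Qed.

(** The functionals are weighted cell averages. Both sides are continuous for the norm, so the
    inequality extends from test functions to their closure. *)
Lemma space_finite_rank : finite_rank_bound (space h) normf mass.
Proof.
move=> e e0; have [n [n' Hphi]] := test_poincare e e0.
pose w p := 2 / fine (nu (cell n n' p)) : R.
have w0 p : 0 <= w p by rewrite mulr_ge0// invr_ge0 fine_ge0.
(* The square root puts the weight 2 / |cell| inside the squared functional. *)
pose ind p : F := fun x => Num.sqrt (w p) * \1_(cell n n' p) x.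
have sind p : sqintO (ind p).
  apply: (sqint_bounded mOm (ind p) (Num.sqrt (w p)) nu_Om).
    apply: measurable_funM => //; apply: measurable_indic; exact: measurable_cell.
  move=> x _; rewrite /ind normrM ger0_norm ?sqrtr_ge0// indicE.
  by rewrite ler_piMr ?sqrtr_ge0//; case: (_ \in _); rewrite ?normr1 ?normr0.
have pI := psd_ip (mu := nu) mOm; have lI := linsub_sqint (mu := nu) mOm.
pose l p (x : E) := ipO x.1.1 (ind p).
(* The sum of all squared norms dominates each of them, giving one constant for every functional. *)
pose C := \sum_p ipO (ind p) (ind p).
have sT : forall x, space h x -> sqintO x.1.1 by move=> x [[]].
have pm := psd_mass h; have pe := psd_energy h; have lT := linsub_triple h.
have pn : psd (triple h) normf by apply: psd_add.
have mn x : triple h x -> mass x x <= normf x x.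
  by move=> tx; rewrite /form_add lerDr (psd_ge0 pe).
exists ('I_n.+1 * 'I_n'.+1)%type, l, C; split.
- by apply: sumr_ge0 => p _; exact: (psd_ge0 pI _ (sind p)).
- move=> p; split => [k x y /sT sx /sT sy|x sx].
    exact: (psdl pI k _ _ _ sx sy (sind p)).
  apply: (le_trans (psd_CS lI pI _ _ (sT x sx) (sind p))).
  rewrite mulrC; have [tx _ _ _] := sx.
  apply: ler_pM; [exact: (psd_ge0 pI _ (sind p))|exact: (psd_ge0 pI _ (sT x sx))| |exact: mn].
  rewrite /C (bigD1 p)//= lerDl; apply: sumr_ge0 => p' _.
  exact: (psd_ge0 pI _ (sind p')).
move=> x [tx _ _ [phi [tphi cphi]]].
have tg k : triple h (grad (phi k)) by exact: triple_grad.
have cm : mass (grad (phi k) - x) (grad (phi k) - x) @[k --> \oo] --> 0.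
  apply: (squeeze_cvgr _ (cvg_cst 0) cphi); apply: nearW => k /=.
  have tB := linsubB _ _ _ lT (tg k) tx.
  by rewrite (psd_ge0 pm _ tB)/= mn.
have c1 := psd_cvg_quad lT pm _ _ tg tx cm.
have c2 := psd_cvg_quad lT pn _ _ tg tx cphi.
have c3 p : l p (grad (phi k)) @[k --> \oo] --> l p x.
  have sg k : sqintO (grad (phi k)).1.1 by case: (tg k).
  have sx : sqintO x.1.1 by case: tx.
  exact: (psd_cvg0 lI pI _ _ _ sg sx (sind p) cm).
have c4 : e * normf (grad (phi k)) (grad (phi k)) + \sum_p l p (grad (phi k)) ^+ 2
    @[k --> \oo] --> e * normf x x + \sum_p l p x ^+ 2.
  apply: cvgD; first by apply: cvgM => //; exact: cvg_cst.
  apply: cvg_big; first exact: add_continuous.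
  by move=> p _; rewrite expr2; apply: cvgM; exact: c3.
apply: (ler_cvg_to c1 c4); apply: nearW => k.
have lE p : l p (grad (phi k)) ^+ 2 = w p * Rintegral nu (cell n n' p) (phi k) ^+ 2.
  have -> : l p (grad (phi k)) = Num.sqrt (w p) * Rintegral nu (cell n n' p) (phi k).
    pose chi : F := \1_(cell n n' p).
    have si : sqintO chi.
      apply: (sqint_bounded mOm chi 1 nu_Om).
        by apply: measurable_indic; exact: measurable_cell.
      by move=> z _; rewrite /chi indicE; case: (_ \in _); rewrite ?normr1 ?normr0.
    have sg : sqintO (phi k) by case: (tg k).
    have -> : l p (grad (phi k)) = Num.sqrt (w p) * ipO (phi k) chi.
      rewrite (psdC pI _ _ sg si) -(psdZl lI pI _ _ _ si sg).
      exact: (psdC pI _ _ sg (sind p)).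
    congr (_ * _); rewrite /ipO [LHS]Rintegral_mkcond [RHS]Rintegral_mkcond.
    apply: eq_Rintegral => z _; rewrite !patchE /chi indicE.
    case: ifPn => zO; case: ifPn => zC; rewrite ?mulr1 ?mulr0//.
    by exfalso; move/negP: zO; apply; rewrite inE; apply: (@cell_Om R n n' p); rewrite -inE.
  by rewrite exprMn sqr_sqrtr.
under eq_bigr do rewrite lE.
apply: (le_trans (Hphi _ (tphi k))); rewrite lerD2r ler_wpM2l ?(ltW e0)//.
by rewrite /form_add lerDl (psd_ge0 pm _ (tg k)).
Qed.
End Compactness.

(** * Weak compactness of potentials *)

Section Potentials.
Context {R : realType}.
Notation T2 := (measurableTypeR R * measurableTypeR R)%type.
Notation F := (R * R -> R).
Notation E := (F * F * F)%type.
Notation sqintO := (sqint (mu := nu) (D := Om)).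
Notation ipO := (ip (mu := nu) (D := Om)).
Variables m M : R.
Hypotheses (m0 : 0 <= m) (mM : m <= M).

Let M0 : 0 <= M. Proof. exact: le_trans mM. Qed.
Let mOm : measurable (Om : set T2) := measurable_Om.
Let pI := psd_ip (mu := nu) mOm.
Let lI := linsub_sqint (mu := nu) mOm.

(* A representative of V satisfying the bounds of inS everywhere. *)
Definition clip (V : F) : F := fun z => Num.min (Num.max (V z) m) M.

Lemma clip_bounds V z : m <= clip V z <= M.
Proof.
rewrite /clip ge_min lexx orbT andbT le_min mM andbT le_max lexx orbT.
by [].
Qed.

Lemma clip_id V z : m <= V z <= M -> clip V z = V z.
Proof. by move=> /andP[mV VM]; rewrite /clip max_l// min_l. Qed.

Lemma clip_meas V : measurable_fun (Om : set T2) V -> measurable_fun (Om : set T2) (clip V).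
Proof.
move=> mV; apply: measurable_minr; last exact: measurable_cst.
by apply: measurable_maxr => //; exact: measurable_cst.
Qed.

Lemma sqint_clip V : measurable_fun (Om : set T2) V -> sqintO (clip V).
Proof.
move=> mV; apply: (sqint_bounded mOm (clip V) M nu_Om); first exact: clip_meas.
move=> x _; have /andP[h1 h2] := clip_bounds V x.
by rewrite ger0_norm// (le_trans m0).
Qed.

Lemma sqint_dominated (f g : F) : measurable_fun (Om : set T2) f -> sqintO g ->
  (forall x, Om x -> `|f x| <= `|g x|) -> sqintO f.
Proof.
move=> mf [mg goo] fg; split => //; apply: le_lt_trans goo.
apply: ge0_le_integral => //.
- by move=> x _; rewrite lee_fin sqr_ge0.
- by apply/measurable_EFinP; exact: measurable_funX.
- by apply/measurable_EFinP; exact: measurable_funX.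
- move=> x Ox; rewrite lee_fin -(real_normK (num_real (f x))).
  by rewrite -(real_normK (num_real (g x))) lerXn2r ?nnegrE// fg.
Qed.

Definition mulclip (V : F) (f : F) : F := fun z => clip V z * f z.
Definition potential (V : F) (f g : F) : R := ipO (mulclip V f) g.
Definition pert (V : F) (x y : E) : R := potential V x.1.1 y.1.1.

Lemma sqint_mulclip V f : measurable_fun (Om : set T2) V -> sqintO f -> sqintO (mulclip V f).
Proof.
move=> mV sf; apply: (@sqint_dominated _ (M *: f)).
- by apply: measurable_funM; [exact: clip_meas|exact: sf.1].
- exact: linsubZ.
- move=> x _; rewrite [leRHS](_ : _ = `|M * f x|)//.
  have /andP[h1 h2] := clip_bounds V x.
  by rewrite !normrM ler_wpM2r// !ger0_norm// (le_trans m0).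
Qed.

Lemma psd_potential V : measurable_fun (Om : set T2) V -> psd sqintO (potential V).
Proof.
move=> mV; split.
- by move=> f g _ _; apply: eq_Rintegral => z _; rewrite /mulclip; ring.
- move=> k f g u sf sg su; rewrite /potential.
  have -> : mulclip V (k *: f + g) = k *: mulclip V f + mulclip V g.
    apply/funext => z.
    change (clip V z * (k * f z + g z) = k * (clip V z * f z) + clip V z * g z).
    by ring.
  by rewrite (psdl pI)//; exact: sqint_mulclip.
- move=> f _; apply: Rintegral_ge0 => z _; rewrite /mulclip -mulrA mulr_ge0//.
    by have /andP[h1 _] := clip_bounds V z; exact: le_trans h1.
  by rewrite -expr2 sqr_ge0.
Qed.

Lemma potential_le V f : measurable_fun (Om : set T2) V -> sqintO f ->
  potential V f f <= M * ipO f f.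
Proof.
move=> mV sf; rewrite -(psdZl lI pI M _ _ sf sf).
apply: le_Rintegral => //.
- exact: sqint_mul_integrable (sqint_mulclip V f mV sf) sf.
- exact: sqint_mul_integrable (linsubZ _ M _ lI sf) sf.
- move=> z _; rewrite [leRHS](_ : _ = M * f z * f z)// /mulclip -!mulrA ler_wpM2r//.
    by rewrite -expr2 sqr_ge0.
  by have /andP[] := clip_bounds V z.
Qed.

Lemma pert_perturbation h V : inS m M V ->
  perturbation (X := space h) (b := mass) (K := M) (pert V).
Proof.
move=> [mV _]; have sT : forall x, space h x -> sqintO x.1.1 by move=> x [[]].
split; last by move=> x /sT sx; exact: potential_le.
exact: (@psd_pullback R E F (space h) sqintO (potential V) (fun x => x.1.1)
   (fun k x y => erefl) sT (psd_potential V mV)).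
Qed.

(* By Riesz, the ultrafilter limits of ipO V_n f are represented by some v in L^2;
   testing with f = (v - M)^+ and f = (m - v)^+ gives its bounds. *)
Lemma potential_weak_limit (V : nat -> F) (U : set_system nat) : UltraFilter U ->
  (forall n, measurable_fun (Om : set T2) (V n)) ->
  exists2 W, inS m M W & forall f, sqintO f ->
    ipO (clip (V n)) f @[n --> U] --> ipO (clip W) f.
Proof.
move=> uU mV; have sV n := sqint_clip _ (mV n).
have pU : ProperFilter U := @ultra_proper _ _ uU.
have s1 : sqintO (cst 1 : F).
  by apply: (sqint_bounded mOm (cst 1 : F) 1 nu_Om) => // x _; rewrite normr1.
pose C := M ^+ 2 * ipO (cst 1) (cst 1).
have C0 : 0 <= C by apply: mulr_ge0; [exact: sqr_ge0|exact: (psd_ge0 pI _ s1)].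
have VC n : ipO (clip (V n)) (clip (V n)) <= C.
  rewrite /C -(psd_quadZ lI pI M _ s1); apply: le_Rintegral => //.
  - exact: sqint_mul_integrable.
  - by apply: sqint_mul_integrable => //; exact: linsubZ.
  - move=> z _; rewrite [leRHS](_ : _ = (M * 1) * (M * 1))// mulr1.
    have /andP[h1 h2] := clip_bounds (V n) z.
    by apply: ler_pM => //; exact: le_trans h1.
have bd n f : sqintO f -> ipO (clip (V n)) f ^+ 2 <= C * ipO f f.
  move=> sf; apply: (le_trans (psd_CS lI pI _ _ (sV n) sf)).
  by rewrite ler_wpM2r//; exact: (psd_ge0 pI _ sf).
pose l f : R := lim (ipO (clip (V n)) f @[n --> U]).
have lc f : sqintO f -> ipO (clip (V n)) f @[n --> U] --> l f.
  move=> sf; have [|c cc] := @ultra_cvg R U (fun n => ipO (clip (V n)) f) (C * ipO f f + 1) uU.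
    move=> n; have H := bd n f sf.
    have K0 : 0 <= C * ipO f f by apply: mulr_ge0 => //; exact: (psd_ge0 pI _ sf).
    rewrite -ler_sqr ?nnegrE//; last by lra.
    by rewrite real_normK ?num_real//; move: H K0; rewrite !expr2; nra.
  by rewrite /l (cvg_lim (@Rhausdorff R) cc).
have [||f sf|v sv Hv] := riesz lI pI l C _ C0.
- by apply: sqint_complete => //; exact: nu_Om.
- move=> k f g sf sg; apply: (cvg_lim (@Rhausdorff R)).
  have -> : (fun n => ipO (clip (V n)) (k *: f + g)) =
      (fun n => k * ipO (clip (V n)) f + ipO (clip (V n)) g).
    by apply/funext => n; rewrite (psdr lI pI).
  by apply: cvgD; [apply: cvgM; [exact: cvg_cst|exact: lc]|exact: lc].
- have c2 : ipO (clip (V n)) f ^+ 2 @[n --> U] --> l f ^+ 2.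
    by rewrite expr2; under eq_fun do rewrite expr2; apply: cvgM; exact: lc.
  by apply: (cvgr_to_le c2); apply: nearW => n; exact: bd.
have mv := sv.1.
have sMv k1 k2 : sqintO (k1 *: cst 1 + k2 *: v).
  by apply: linsubD => //; exact: linsubZ.
(* Used with s = 1 and s = -1 for the two bounds. With f the positive part of g = s v - c, the
   pairing of g with f is that of f with itself, and it is at most 0 as a limit of nonpositive
   pairings. *)
have pos (s c : R) : (forall n z, s * clip (V n) z <= c) ->
    {ae nu, forall z, Om z -> s * v z <= c}.
  move=> sc; pose g : F := - c *: cst 1 + s *: v.
  have gE z : g z = s * v z - c.
    by change (- c * 1 + s * v z = s * v z - c); ring.
  have sg : sqintO g by exact: sMv.
  pose f : F := fun z => Num.max (g z) 0.
  have mf : measurable_fun (Om : set T2) f.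
    by apply: measurable_maxr; [exact: sg.1|exact: measurable_cst].
  have f0 z : 0 <= f z by rewrite /f le_max lexx orbT.
  have sf : sqintO f.
    apply: (sqint_dominated f g mf sg) => z _; rewrite ger0_norm// /f ge_max normr_ge0 andbT.
    exact: ler_norm.
  have gf : ipO g f = ipO f f.
    apply: eq_Rintegral => z _; rewrite /f; case: (leP (g z) 0) => //.
    by rewrite !mulr0.
  have vf : s * ipO v f <= c * ipO (cst 1) f.
    rewrite Hv//.
    have c1 : s * ipO (clip (V n)) f @[n --> U] --> s * l f.
      by apply: cvgM; [exact: cvg_cst|exact: lc].
    apply: (cvgr_to_le c1); apply: nearW => n.
    rewrite -(psdZl lI pI s _ _ (sV n) sf) -(psdZl lI pI c _ _ s1 sf).
    apply: le_Rintegral => //.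
    - by apply: sqint_mul_integrable => //; exact: linsubZ.
    - by apply: sqint_mul_integrable => //; exact: linsubZ.
    - move=> z _; rewrite [leLHS](_ : _ = s * clip (V n) z * f z)//.
      by rewrite [leRHS](_ : _ = c * 1 * f z)// mulr1 ler_wpM2r.
  have ff : ipO f f = 0.
    apply/eqP; rewrite eq_le (psd_ge0 pI _ sf) andbT -gf.
    rewrite (psdl pI)//; last exact: linsubZ.
    by rewrite (psdZl lI pI)//; lra.
  apply: filterS (ip_eq0 mOm f sf ff) => z H Oz.
  by have := H Oz; rewrite /f gE; case: (leP (s * v z - c) 0) => *; lra.
have vM : {ae nu, forall z, Om z -> v z <= M}.
  have H : forall n z, 1 * clip (V n) z <= M.
    by move=> n z; have /andP[_ h2] := clip_bounds (V n) z; lra.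
  by apply: (@filterS _ (almost_everywhere nu) _ _ _ _ (pos 1 M H)) => z {}H Oz; have := H Oz; lra.
have vm : {ae nu, forall z, Om z -> m <= v z}.
  have H : forall n z, -1 * clip (V n) z <= - m.
    by move=> n z; have /andP[h1 _] := clip_bounds (V n) z; lra.
  apply: (@filterS _ (almost_everywhere nu) _ _ _ _ (pos (-1) (- m) H)) => z {}H Oz.
  by have := H Oz; lra.
exists v.
  split => //; apply: (@filterS2 _ (almost_everywhere nu) _ _ _ _ _ vM vm) => z H1 H2 Oz.
  by rewrite H1// H2.
(* v satisfies the bounds almost everywhere, so clipping does not change its pairings. *)
move=> f sf; suff -> : ipO (clip v) f = l f by exact: lc.
rewrite -Hv//; apply/eqP; rewrite -subr_eq0 -(psdBl pI)//; last exact: sqint_clip.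
apply/eqP; apply: ip_ae0 => //.
- apply: (@filterS2 _ (almost_everywhere nu) _ _ _ _ _ vM vm) => z H1 H2 Oz.
  change (clip v z - v z = 0); rewrite clip_id ?subrr//.
  by rewrite H1// H2.
- by apply: measurable_funB => //; exact: clip_meas.
- exact: sf.1.
Qed.

(** u^2 need not lie in L^2, so weak convergence cannot be tested with it. u is approximated in L^2
    by a test function f, whose square is admissible; [psd_quad_diff] bounds the error uniformly in
    the potential. *)
Lemma pert_compact (h : R -> R) (V : nat -> F) (U : set_system nat) :
  (forall x, 0 < x < 1 -> 0 < h x) -> (exists B, forall x, 0 < x < 1 -> h x <= B) ->
  measurable_fun (Om : set T2) (fun z => h z.1) ->
  (forall n, inS m M (V n)) -> UltraFilter U ->
  exists2 W, inS m M W & forall x, space h x -> pert (V n) x x @[n --> U] --> pert W x x.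
Proof.
move=> h_gt0 h_bdd h_meas SV uU; have mV n : measurable_fun (Om : set T2) (V n) by case: (SV n).
have [W SW HW] := potential_weak_limit V U uU mV; exists W => // x [tx _ _ [phi [tphi cphi]]].
have sx : sqintO x.1.1 by case: tx.
set u := x.1.1 in sx.
have pU : ProperFilter U := @ultra_proper _ _ uU.
apply/cvgrPdist_le => e e0.
(* Bound for the mass of u + f: that of f is at most 2 |u|^2 + 2 d, so that of u + f is at most 6
   |u|^2 + 4 d, with d <= 1. *)
pose D := 6 * ipO u u + 4.
have u0 := psd_ge0 pI _ sx.
have D0 : 0 < D by rewrite /D; lra.
pose d := Num.min 1 ((e / 3) ^+ 2 / (M ^+ 2 * D + 1)).
have MD : 0 < M ^+ 2 * D + 1 by have := mulr_ge0 (sqr_ge0 M) (ltW D0); lra.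
have e3 : 0 < e / 3 by rewrite divr_gt0.
have d0 : 0 < d by rewrite lt_min ltr01 divr_gt0// exprn_gt0.
have d1 : d <= 1 by rewrite ge_min lexx.
have dM : M ^+ 2 * (d * D) <= (e / 3) ^+ 2.
  have d2 : d <= (e / 3) ^+ 2 / (M ^+ 2 * D + 1) by rewrite ge_min lexx orbT.
  have := d2; rewrite ler_pdivlMr// => H.
  by have := mulr_ge0 (sqr_ge0 M) (ltW D0); nra.
have [f [cf fd]] : exists f : F, continuous f /\ ipO (u - f) (u - f) <= d.
  have /cvgrPdist_le/(_ _ d0)[k _ /(_ k (leqnn k))/=] := cphi.
  rewrite sub0r normrN => H; exists (phi k); split; first exact: test_fun_continuous.
  have tg : triple h (grad (phi k)) by exact: triple_grad.
  have sg : sqintO (phi k) by case: tg.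
  rewrite (psd_quadN lI pI)//; apply: le_trans (le_trans (ler_norm _) H).
  have := psd_ge0 (psd_energy h) _ (linsubB _ _ _ (linsub_triple h) tg tx).
  by rewrite /form_add -[ipO _ _]/(mass (grad (phi k) - x) (grad (phi k) - x)); lra.
have sf := sqint_continuous _ cf.
have sB := linsubB _ _ _ lI sx sf; have sD := linsubD _ _ _ lI sx sf.
have uf : ipO (u + f) (u + f) <= D.
  have h1 := psd_quad_le2 lI pI _ _ sx sf.
  have h4 := psd_quad_le2 lI pI _ _ sx (linsubZ _ (-1) _ lI sB).
  move: h4; rewrite (psd_quadZ lI pI)// scaleN1r opprB addrC subrK => h4.
  by rewrite /D; lra.
have osc Z : measurable_fun (Om : set T2) Z -> `|potential Z u u - potential Z f f| <= e / 3.
  move=> mZ; rewrite -ler_sqr ?nnegrE ?(ltW e3)//.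
  rewrite real_normK ?num_real//; apply: le_trans dM.
  have pZ := psd_potential Z mZ.
  apply: (le_trans (psd_quad_diff lI pZ _ _ sx sf)).
  have k1 := potential_le Z _ mZ sB; have k2 := potential_le Z _ mZ sD.
  have z1 := psd_ge0 pZ _ sB; have z2 := psd_ge0 pZ _ sD.
  have k1' : potential Z (u - f) (u - f) <= M * d by apply: (le_trans k1); rewrite ler_wpM2l.
  have k2' : potential Z (u + f) (u + f) <= M * D by apply: (le_trans k2); rewrite ler_wpM2l.
  by apply: (le_trans (ler_pM z1 z2 k1' k2')); rewrite le_eqVlt; apply/orP; left; apply/eqP; ring.
have sff : sqintO (fun z => f z * f z).
  by apply: sqint_continuous => z; apply: cvgM; exact: cf.
have pf Z : potential Z f f = ipO (clip Z) (fun z => f z * f z).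
  by apply: eq_Rintegral => z _; rewrite /mulclip; ring.
have /cvgrPdist_le/(_ _ e3) := HW _ sff.
apply: filterS => n /=; rewrite -!pf.
have := osc W SW.1; have := osc (V n) (mV n).
rewrite !ler_norml /pert -/u.
by move=> /andP[? ?] /andP[? ?] /andP[? ?]; apply/andP; split; lra.
Qed.
End Potentials.

(** * The minimising potential *)

Section WeakEigenvalues.
Context {R : realType}.
Variables (h : R -> R) (m M : R).
Notation T2 := (measurableTypeR R * measurableTypeR R)%type.
Notation F := (R * R -> R).
Notation E := (F * F * F)%type.
Notation sqintO := (sqint (mu := nu) (D := Om)).
Notation ipO := (ip (mu := nu) (D := Om)).
Hypotheses (m0 : 0 <= m) (mM : m <= M).
Hypothesis h_gt0 : forall x, 0 < x < 1 -> 0 < h x.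
Hypothesis h_bdd : exists B, forall x, 0 < x < 1 -> h x <= B.
Hypothesis h_meas : measurable_fun (Om : set T2) (fun z => h z.1).

Let mOm : measurable (Om : set T2) := measurable_Om.
Let pI := psd_ip (mu := nu) mOm.

Section OnePotential.
Variable V : F.
Hypothesis SV : inS m M V.
Notation eig := (eigvec (X := space h) (a0 := energy h) (b := mass) (p := pert m M V)).

(** V equals its clipped version almost everywhere on the square, and h g2 w2 is the product of the
    two weighted derivatives. *)
Lemma weak_formE x y : triple h x -> triple h y ->
  Rintegral mu2 Om (fun z => x.1.2 z * y.1.2 z + h z.1 * x.2 z * y.2 z + V z * x.1.1 z * y.1.1 z)
  = form_add (energy h) (pert m M V) x y.
Proof.
case: x y => [[u g1] g2] [[v w1] w2] [/= su sg1 mg2 sg2] [/= sv sw1 mw2 sw2].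
have [mV bV] := SV; have suV := sqint_mulclip _ _ m0 mM _ _ mV su.
have i1 := sqint_mul_integrable mOm _ _ sg1 sw1.
have i2 := sqint_mul_integrable mOm _ _ sg2 sw2.
have i3 := sqint_mul_integrable mOm _ _ suV sv.
rewrite /form_add /energy /pert /potential /= /ip.
rewrite -RintegralD// -RintegralD//; last first.
  by have := integrableD mOm i1 i2; apply: eq_integrable => // z _; rewrite EFinD.
congr fine; apply: ae_eq_integral => //.
- apply/measurable_EFinP; apply: measurable_funD.
    apply: measurable_funD; first by apply: measurable_funM; [exact: sg1.1|exact: sw1.1].
    by apply: measurable_funM => //; exact: measurable_funM.
  by apply: measurable_funM; [apply: measurable_funM => //; exact: su.1|exact: sv.1].
- apply/measurable_EFinP; apply: measurable_funD.
    apply: measurable_funD; first by apply: measurable_funM; [exact: sg1.1|exact: sw1.1].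
    by apply: measurable_funM; [exact: sg2.1|exact: sw2.1].
  by apply: measurable_funM; [exact: suV.1|exact: sv.1].
- apply: (@filterS _ (almost_everywhere nu) _ _ _ _ bV) => z bz Oz; congr (_ %:E).
  rewrite /mulclip clip_id; last exact: bz.
  rewrite /wt; congr (_ + _ + _).
  have -> : Num.sqrt (h z.1) * g2 z * (Num.sqrt (h z.1) * w2 z) =
    Num.sqrt (h z.1) ^+ 2 * g2 z * w2 z by ring.
  by rewrite sqr_sqrtr// ltW// h_gt0//; exact: Oz.1.
Qed.

Lemma mass_gt0P (x : E) : triple h x ->
  0 < mass x x <-> ~ {ae mu2, forall z, Om z -> x.1.1 z = 0}.
Proof.
move=> [sx _ _ _]; split.
  by move=> + x0; rewrite /mass (ip_ae0 mOm _ _ x0 sx.1 sx.1) ltxx.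
move=> nx; rewrite lt_neqAle (psd_ge0 pI _ sx) andbT eq_sym; apply/eqP => x0.
by apply: nx; exact: (ip_eq0 mOm _ sx x0).
Qed.

Lemma eigenfunP lam u : eigenfun h V lam u <-> exists g1 g2, eig lam (u, g1, g2).
Proof.
split=> [[g1 [g2 [/(spaceP h h_gt0 h_bdd h_meas) sx nx Hx]]]|[g1 [g2 [sx x0 Hx]]]].
  have [tx _ _ _] := sx.
  exists g1, g2; split => //; first exact/mass_gt0P.
  move=> [[v w1] w2] sy; have [ty _ _ _] := sy.
  rewrite -weak_formE//; apply: Hx.
  by apply/(spaceP h h_gt0 h_bdd h_meas).
have [tx _ _ _] := sx.
exists g1, g2; split.
- by apply/(spaceP h h_gt0 h_bdd h_meas).
- exact: (proj1 (mass_gt0P _ tx) x0).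
- move=> v w1 w2 /(spaceP h h_gt0 h_bdd h_meas) sy; have [ty _ _ _] := sy.
  by have := Hx _ sy; rewrite -weak_formE.
Qed.

(** Eigenvalue sets and multiplicity conditions coincide: almost everywhere vanishing is zero mass,
    for single functions and for combinations of two. *)
Lemma GammaE : Gamma h V = gap (X := space h) (a0 := energy h) (b := mass) (pert m M V).
Proof.
have specE : [set l | Defs.eigenvalue h V l] =
    spec (X := space h) (a0 := energy h) (b := mass) (pert m M V).
  apply/seteqP; split => l /=.
    by move=> [u /eigenfunP[g1 [g2 e]]]; exists (u, g1, g2).
  by move=> [[[u g1] g2] e]; exists u; apply/eigenfunP; exists g1, g2.
have doubleE l : mult_ge2 h V l <->
    double_eig (X := space h) (a0 := energy h) (b := mass) (pert m M V) l.
  split.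
    move=> [u1 [u2 [/eigenfunP[g1 [g2 ex]] /eigenfunP[w1 [w2 ey]] ind]]].
    exists (u1, g1, g2), (u2, w1, w2); split => // s t st0; apply: ind.
    have [[[su1 _ _ _] _ _ _] _ _] := ex; have [[[su2 _ _ _] _ _ _] _ _] := ey.
    have sc : sqintO (s *: u1 + t *: u2).
      apply: linsubD; [exact: linsub_sqint|apply: linsubZ => //|apply: linsubZ => //];
      exact: linsub_sqint.
    exact: (ip_eq0 mOm _ sc st0).
  move=> [[[u1 g1] g2] [[[u2 w1] w2] [ex ey ind]]]; exists u1, u2; split.
  - by apply/eigenfunP; exists g1, g2.
  - by apply/eigenfunP; exists w1, w2.
  - move=> s t st0; apply: ind.
    have [[[su1 _ _ _] _ _ _] _ _] := ex; have [[[su2 _ _ _] _ _ _] _ _] := ey.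
    have mc : measurable_fun (Om : set T2) (s *: u1 + t *: u2).
      by apply: measurable_funD; apply: measurable_funM => //; [exact: su1.1|exact: su2.1].
    exact: (ip_ae0 mOm _ _ st0 mc mc).
have l1E : lambda1 h V = first_eig (X := space h) (a0 := energy h) (b := mass) (pert m M V).
  by rewrite /lambda1 specE.
rewrite /Gamma /gap l1E; congr (_ - _); rewrite /lambda2 /second_eig l1E.
rewrite (asbool_equiv_eq (doubleE _)); congr (if _ then _ else inf _).
apply/seteqP; split => l /= [el ll]; split => //.
  by rewrite -specE.
by rewrite -specE in el.
Qed.
End OnePotential.
End WeakEigenvalues.

Theorem theorem5p4 (R : realType) (h : R -> R) (m M : R)
  (h_bdd : exists B : R, forall x : R, 0 <= x <= 1 -> `|h x| <= B)
  (h_0 : h 0 = 0)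
  (h_pos : forall x : R, 0 < x <= 1 -> 0 < h x)
  (h_C1 : {within `]0, 1], continuous h} /\
          exists h' : R -> R, {within `]0, 1], continuous h'} /\
            forall x : R, 0 < x < 1 -> is_derive x 1 h (h' x))
  (h_cond : exists C theta : R, [/\ 0 < C, 0 < theta < 1 &
     forall (x : R * R) (r : R), Om x -> 0 < r <= Num.sqrt 2 ->
       (\int[@mu2 R]_(y in ball2 x r `&` Om) ((h y.1)^-1)%:E
         <= C%:E * ((fine (@mu2 R (ball2 x r `&` Om))) `^ theta)%:E)%E])
  (m_ge0 : 0 <= m) (M_ge0 : 0 <= M) (mM : m <= M) :
  exists Vs : R * R -> R,
    inS m M Vs /\ Gamma h Vs = inf [set Gamma h V | V in inS m M].
Proof.
have ch : {within `]0, 1], continuous h} := h_C1.1.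
have hgt0 x : 0 < x < 1 -> 0 < h x.
  by move=> /andP[x0 x1]; apply: h_pos; rewrite x0 ltW.
have hbdd : exists B, forall x, 0 < x < 1 -> h x <= B.
  have [B HB] := h_bdd; exists B => x /andP[x0 x1].
  by apply: (le_trans (ler_norm _)); apply: HB; rewrite !ltW.
have hmeas : measurable_fun (Om : set (measurableTypeR R * measurableTypeR R)) (fun z => h z.1).
  have mD : measurable (`]0, 1]%classic : set R) by exact: measurable_itv.
  have mh : measurable_fun (`]0, 1]%classic : set R) h.
    exact: (subspace_continuous_measurable_fun mD ch).
  have sub : fst @` (Om : set (measurableTypeR R * measurableTypeR R))
      `<=` (`]0, 1]%classic : set R).
    by move=> _ [z [/andP[z0 z1] _] <-]; rewrite /= in_itv /= z0 ltW.
  have mf : measurable_fun (Om : set (measurableTypeR R * measurableTypeR R)) fst.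
    exact: measurable_funTS.
  exact (measurable_comp mD sub mh mf).
(* A positive continuous function attains a positive minimum on [r, 1]; for r >= 1 the range of x is
   empty. *)
have hlow r : 0 < r -> exists2 c, 0 < c & forall x, r < x < 1 -> c <= h x.
  move=> r0; have [r1|r1] := leP 1 r.
    by exists 1 => // x /andP[rx x1]; have := lt_trans rx x1; rewrite ltNge r1.
  have cr : {within `[r, 1], continuous h}.
    apply: continuous_subspaceW ch => x; rewrite /= !in_itv /= => /andP[rx ->].
    by rewrite andbT (lt_le_trans r0).
  have [c] := EVT_min (ltW r1) cr; rewrite in_itv /= => /andP[rc c1] Hc.
  exists (h c); first by apply: h_pos; rewrite c1 andbT (lt_le_trans r0).
  by move=> x /andP[rx x1]; apply: Hc; rewrite in_itv /= !ltW.
(* Centre (1/2, 1/2), radius sqrt 2: the ball covers the square, so the condition bounds the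
   integral of 1/h over all of it. *)
have hint : (\int[nu]_(z in Om) ((h z.1)^-1)%:E < +oo)%E.
  have [C [theta [C0 _ /(_ (2^-1, 2^-1) (Num.sqrt 2))]]] := h_cond.
  have -> : ball2 (2^-1, 2^-1) (Num.sqrt 2) `&` Om = @Om R.
    apply/setIidPr => z [/andP[a1 a2] /andP[b1 b2]].
    rewrite /ball2 /= sqr_sqrtr//.
    have h1 : (z.1 - 2^-1) ^+ 2 < 1 by rewrite expr2; nra.
    have h2 : (z.2 - 2^-1) ^+ 2 < 1 by rewrite expr2; nra.
    by lra.
  move=> H; apply: (le_lt_trans (H _ _)).
  - have H2 : (0 < (2^-1 : R) < 1)%R by rewrite invr_gt0 ltr0n invf_lt1 ?ltr1n ?ltr0n.
    by split.
  - by rewrite sqrtr_gt0 ltr0n lexx.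
  - by rewrite -EFinM ltry.
have sT := linsub_triple h; have sX := linsub_space h hgt0 hbdd hmeas.
have XT : forall x, space h x -> triple h x by move=> x [].
have pe := psd_sub _ _ _ XT (psd_energy h).
have pm := psd_sub _ _ _ XT (psd_mass h).
have cX := space_complete h hgt0 hbdd hmeas hint.
have fb := space_finite_rank h hgt0 hbdd hmeas hlow.
have [|||W SW HW] := gap_minimizer (S := inS m M) (P := pert m M) sX pe pm M_ge0 cX fb.
- by move=> V SV; exact: pert_perturbation.
- by move=> V U SV uU; exact: pert_compact.
- exists (cst m); split; first exact: measurable_cst.
  by apply: aeW => z _; rewrite /= lexx mM.
exists W; split => //; rewrite (GammaE h m M)// HW; congr inf.
by apply/seteqP; split => _ [V SV <-]; exists V; rewrite ?(GammaE h m M).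
Qed.
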